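(* Let $K$ be the algebraic closure of a finite field $\mathbb{F}_q$ of characteristic $p$. Let $\alpha_1,\dots,\alpha_r\in K$ be pairwise distinct, let $m$ be a positive integer with $p\nmid m$, let $\lambda_1,\dots,\lambda_r$ be integers with $1\le\lambda_i<m$, set $\lambda_0:=\sum_{i=1}^r\lambda_i$ and suppose $\gcd(m,\lambda_0)=1$. Let $\mathcal{F}=K(x,y)$ be the function field of the curve $y^m=\prod_{i=1}^r(x-\alpha_i)^{\lambda_i}$. Suppose that $\lambda_{\ell_1}=\lambda_{\ell_2}$ and $\gcd(m,\lambda_{\ell_1})=1$ for some distinct $1\le\ell_1,\ell_2\le r$. Let $\lambda$ be the inverse of $\lambda_{\ell_1}$ modulo $m$, and for $s=1,2$ let $Q_{\ell_s}$ be the unique place of $\mathcal{F}$ lying over the zero of $x-\alpha_{\ell_s}$ in $K(x)$. Then $$\Gamma(Q_{\ell_1},Q_{\ell_2})=\left\{(i+mj_1,\,i+mj_2)\in\mathbb{N}^2\ \middle|\ 1\le i\le m-1,\ j_1\ge0,\ j_2\ge0,\ j_1+j_2=\left(\sum_{k=1}^r\left\lceil\frac{i\lambda\lambda_k}{m}\right\rceil\right)-\left\lceil\frac{i\lambda\lambda_0}{m}\right\rceil-1\right\},$$ where $i,j_1,j_2$ range over integers.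
   Context: $\mathbb{N}=\{0,1,2,\dots\}$; $\lceil\cdot\rceil$ is the ceiling function; $(z)_\infty$ is the pole divisor of $z$. For a place $P$ of $\mathcal{F}/K$: $H(P)=\{s\in\mathbb{N}\mid (z)_\infty=sP\text{ for some }z\in\mathcal{F}\}$ and $G(P)=\mathbb{N}\setminus H(P)$. For two distinct places: $H(P_1,P_2)=\{(s_1,s_2)\in\mathbb{N}^2\mid (z)_\infty=s_1P_1+s_2P_2\text{ for some }z\in\mathcal{F}\}$. Minimal generating set: for $\beta\in G(P_1)$ let $n_\beta=\min\{\gamma\in\mathbb{N}\mid(\beta,\gamma)\in H(P_1,P_2)\}$. It is known that $\beta\mapsto n_\beta$ is a bijection $G(P_1)\to G(P_2)$. The minimal generating set of $H(P_1,P_2)$ is its graph $\Gamma(P_1,P_2)=\{(\beta,n_\beta)\mid\beta\in G(P_1)\}$. *)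

(* Defs.v *)
From HB Require Import structures.
From mathcomp Require Import all_boot all_order all_algebra all_field.
From mathcomp Require Import boolp classical_sets functions.

Set Implicit Arguments.
Unset Strict Implicit.
Unset Printing Implicit Defensive.

Import Order.TTheory GRing.Theory Num.Theory.

Local Open Scope classical_set_scope.
Local Open Scope ring_scope.

Section Places.

Variables (K F : fieldType) (iota : {rmorphism K -> F}).

(* A place P of F / K is represented by its valuation ring O_P, a ring with
   K < O_P < F (strict inclusions) containing z or z^-1 for every z; P itself
   is recovered as the set of non-units of O_P, see [maximal_ideal]. *)
Record place := Place {
  valuation_ring : set F;
  _ : subring_closed [pred z | z \in valuation_ring];
  _ : range iota `<` valuation_ring;
  _ : valuation_ring `<` setT;
  _ : forall z : F, valuation_ring z \/ valuation_ring z^-1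
}.

Implicit Types (P Q : place) (z : F).

Definition valuation_unit P z : Prop := [/\ z != 0, valuation_ring P z & valuation_ring P z^-1].

Definition maximal_ideal P : set F :=
  [set z | valuation_ring P z /\ ~ valuation_unit P z].

Definition uniformizer P (t : F) : Prop :=
  maximal_ideal P = [set t * w | w in valuation_ring P].

(* v_P(z), for z != 0. The junk value v_P(0) = 0 makes the pole divisor of 0
   equal to 0, just as v_P(0) = +oo would. *)
Definition valuation P z : int :=
  xget 0 [set n : int |
    exists t u, [/\ uniformizer P t, valuation_unit P u & z = t ^ n * u]].

Definition is_zero z P : Prop := 0 < valuation P z.

(* Divisors are compared as integer-valued functions on the set of places. *)
Definition prime_divisor P : place -> int := fun Q => (`[< Q = P >] : nat)%:Z.

Definition pole_divisor z : place -> int :=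
  fun P => Num.max 0 (- valuation P z).

Definition pole_semigroup P : set nat :=
  [set s | exists z, pole_divisor z = prime_divisor P *+ s].

Definition gaps P : set nat := ~` pole_semigroup P.

Definition pole_semigroup2 P1 P2 : set (nat * nat) :=
  [set s | exists z,
     pole_divisor z = prime_divisor P1 *+ s.1 + prime_divisor P2 *+ s.2].

Definition set_min (A : set nat) : nat :=
  xget 0%N [set n | A n /\ forall k, A k -> (n <= k)%N].

Definition least_partner P1 P2 (b : nat) : nat :=
  set_min [set c | pole_semigroup2 P1 P2 (b, c)].

Definition minimal_generating_set P1 P2 : set (nat * nat) :=
  [set (b, least_partner P1 P2 b) | b in gaps P1].

End Places.

Notation ratfun K := {fraction {poly K}}.

Definition ratfun_const (K : fieldType) : {rmorphism K -> ratfun K} :=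
  @tofrac {poly K} \o polyC.

Definition funfield_const (K : fieldType) (F : fieldExtType (ratfun K)) :
    {rmorphism K -> F} :=
  in_alg F \o ratfun_const K.

(* The element x of F. *)
Definition funfield_x (K : fieldType) (F : fieldExtType (ratfun K)) : F :=
  in_alg F (tofrac 'X).

Definition lies_over (K : fieldType) (F : fieldExtType (ratfun K))
    (Q : place (funfield_const F)) (P : place (ratfun_const K)) : Prop :=
  in_alg F @` maximal_ideal P `<=` maximal_ideal Q.

(* Main.v *)
Require Import Defs.
From HB Require Import structures.
From mathcomp Require Import all_boot all_order all_algebra all_field.
From mathcomp Require Import boolp classical_sets functions.
From mathcomp Require Import ring zify.
From mathcomp Require cyclic.

Set Implicit Arguments.
Unset Strict Implicit.
Unset Printing Implicit Defensive.

Import Order.TTheory GRing.Theory Num.Theory.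

Local Open Scope classical_set_scope.
Local Open Scope ring_scope.

(** The proof splits functions into eigenvectors of the deck group.  Since K
    contains the m-th roots of unity and p does not divide m, the field F is
    the direct sum of the lines K(x) y^j, 0 <= j < m, and these are the
    eigenspaces of the automorphisms y |-> zeta y.  The two places Q1 and Q2
    are totally ramified over the line, hence fixed by these automorphisms, so
    averaging over them shows that a function without poles outside {Q1, Q2}
    is a sum of monomials a(x) y^j which have no pole there either
    ([term_regular_off]).  Moreover the order of a(x) y^j at Q1 is congruent to
    j lam_l1 modulo m.  Distinct monomials therefore have distinct orders, and
    the order of a sum is the smallest order of its terms
    ([combination_order]).  Hence pole orders at Q1 and least partners can be
    read off from monomials alone.

    Every monomial can be written as a(x) y^(- i laminv) with 0 <= i < m.  Its
    pole orders at Q1 and Q2 then have the form i + m j1 and i + m j2.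
    Regularity at the places over any other alpha_k forces the order of a at
    alpha_k to be at least the ceiling of i laminv lam_k / m, regularity at
    infinity bounds the degree of a, and because a rational function has as many
    zeros as poles these constraints amount to j1 + j2 >= t_i, where
    t_i is the right hand side of the equation in the theorem
    ([monomial_bound], which rests on [degree_bound]).  Conversely a product of
    powers of the x - alpha_k and of y realizes every such pair (j1, j2)
    ([monomial_pole_divisor]).  Taking j2 = -1 shows that the gaps at Q1 are the
    numbers i + m j1 with 1 <= i < m and 0 <= j1 <= t_i; the least partner of
    such a gap is i + m (t_i - j1).

    Places are arbitrary valuation rings, so three foundations are needed.
    There is a place over each point of the projective line
    ([place_exists], by Zorn's lemma); it is used to turn regularity into
    inequalities.  Every place is discrete ([vr_valuationE]), so that
    nonnegative valuation means membership in the valuation ring.  The place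
    over a totally ramified branch point is unique ([over_branch_unique]).
    Ramification indices are avoided throughout: z^M is compared with powers of
    a function of x, for a fixed M, and orders are read off from there. *)

(** * Subrings of a field and maximal subrings avoiding an inverse *)

Section Subrings.

Variables (F : fieldType) (S : set F).
Hypothesis S_ring : subring_closed [pred z | z \in S].
Implicit Types x y z : F.

Lemma subring1 : S 1.
Proof. by have [+ _ _] := S_ring; rewrite !inE. Qed.

Lemma subringB x y : S x -> S y -> S (x - y).
Proof. by have [_ + _] := S_ring => /(_ x y); rewrite !inE. Qed.

Lemma subringM x y : S x -> S y -> S (x * y).
Proof. by have [_ _ +] := S_ring => /(_ x y); rewrite !inE. Qed.

Lemma subring0 : S 0.
Proof. by rewrite -(subrr 1); apply: subringB; exact: subring1. Qed.

Lemma subringN x : S x -> S (- x).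
Proof. by move=> Sx; rewrite -sub0r; apply: subringB => //; exact: subring0. Qed.

Lemma subringD x y : S x -> S y -> S (x + y).
Proof. by move=> Sx Sy; rewrite -[y]opprK; apply/subringB/subringN. Qed.

Lemma subring_sum (I : Type) (r : seq I) (C : pred I) (f : I -> F) :
  (forall i, C i -> S (f i)) -> S (\sum_(i <- r | C i) f i).
Proof. by move=> Sf; apply: big_ind => //; [exact: subring0 | exact: subringD]. Qed.

Lemma subring_prod (I : Type) (r : seq I) (C : pred I) (f : I -> F) :
  (forall i, C i -> S (f i)) -> S (\prod_(i <- r | C i) f i).
Proof. by move=> Sf; apply: big_ind => //; [exact: subring1 | exact: subringM]. Qed.

Lemma subringX x n : S x -> S (x ^+ n).
Proof. by move=> Sx; rewrite -[n]card_ord -prodr_const; exact: subring_prod. Qed.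

Definition coefs_in (q : {poly F}) := forall i, S q`_i.

Lemma coefs_inC x : S x -> coefs_in x%:P.
Proof. by move=> Sx i; rewrite coefC; case: eqP => // _; exact: subring0. Qed.

Lemma coefs_inXn n : coefs_in 'X^n.
Proof.
by move=> i; rewrite coefXn; case: eqP => _; [exact: subring1|exact: subring0].
Qed.

Lemma coefs_inX : coefs_in 'X.
Proof. exact: (@coefs_inXn 1). Qed.

Lemma coefs_inB p q : coefs_in p -> coefs_in q -> coefs_in (p - q).
Proof. by move=> Sp Sq i; rewrite coefB; exact: subringB. Qed.

Lemma coefs_inD p q : coefs_in p -> coefs_in q -> coefs_in (p + q).
Proof. by move=> Sp Sq i; rewrite coefD; exact: subringD. Qed.

Lemma coefs_inM p q : coefs_in p -> coefs_in q -> coefs_in (p * q).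
Proof.
by move=> Sp Sq i; rewrite coefM; apply: subring_sum => j _; exact: subringM.
Qed.

Definition adjoin z : set F := [set w | exists2 q, coefs_in q & w = q.[z]].

Lemma adjoin_ring z : subring_closed [pred w | w \in adjoin z].
Proof.
split=> [|x y|x y]; rewrite !inE.
- by exists 1%:P; [apply: coefs_inC; exact: subring1 | rewrite hornerC].
- by move=> [p Sp ->] [q Sq ->]; exists (p - q);
    [exact: coefs_inB | rewrite hornerD hornerN].
- by move=> [p Sp ->] [q Sq ->]; exists (p * q); [exact: coefs_inM | rewrite hornerM].
Qed.

Lemma sub_adjoin z : S `<=` adjoin z.
Proof. by move=> x Sx; exists x%:P; [exact: coefs_inC | rewrite hornerC]. Qed.

Lemma mem_adjoin z : adjoin z z.
Proof. by exists 'X; [exact: coefs_inX | rewrite hornerX]. Qed.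

End Subrings.

Section MaximalSubring.

Variables (F : fieldType) (B : set F) (pi : F).
Hypotheses (B_ring : subring_closed [pred z | z \in B])
  (pi0 : pi != 0) (Bpi : B pi) (nBpi : ~ B pi^-1).
Hypothesis B_max : forall C : set F, subring_closed [pred z | z \in C] ->
  B `<` C -> C pi^-1.

Let adjoin_pi z : ~ B z -> adjoin B z pi^-1.
Proof.
move=> nBz; apply: B_max; first exact: adjoin_ring.
split; first exact: sub_adjoin.
by move/(_ z (mem_adjoin B_ring z)).
Qed.

(** This is how the maximal [B] is local: were [1 - pi b] not invertible in
    [B], adjoining its inverse would bring in [pi^-1], and clearing
    denominators would then put [pi^-1] into [B] itself, because every power
    of [1 - pi b] is congruent to 1 modulo [pi]. *)
Lemma one_sub_unit b : B b -> B (1 - pi * b)^-1.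
Proof.
move=> Bb; set c := 1 - pi * b; apply: contrapT => nBc.
have Bc : B c by apply: subringB => //; [exact: subring1|exact: subringM].
have c0 : c != 0.
  apply/eqP => c0; apply: nBpi; suff -> : pi^-1 = b by [].
  by apply: (mulfI pi0); rewrite divff //; apply/eqP; rewrite -subr_eq0 -/c c0.
have Bcn n : exists2 d, B d & c ^+ n = 1 - pi * d.
  elim: n => [|n [d Bd IHn]].
    by exists 0; [exact: subring0 | rewrite mulr0 subr0].
  exists (b + d * c).
    by apply: subringD => //; exact: subringM.
  by rewrite exprSr IHn /c; ring.
have [q Sq qE] := adjoin_pi nBc; have [d Bd cE] := Bcn (size q).
apply: nBpi; suff -> : pi^-1 = \sum_(i < size q) q`_i * c ^+ (size q - i) + d.
  apply: subringD => //; apply: subring_sum => // i _.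
  by apply: subringM => //; exact: subringX.
have -> : \sum_(i < size q) q`_i * c ^+ (size q - i) = c ^+ size q * q.[c^-1].
  rewrite horner_coef mulr_sumr; apply: eq_bigr => i _.
  rewrite mulrCA; congr (_ * _); rewrite exprVn.
  have -> : c ^+ size q = c ^+ (size q - i) * c ^+ i by rewrite -exprD subnK // ltnW.
  by rewrite mulfK ?expf_neq0.
by rewrite -qE cE mulrBl mul1r mulrAC divff ?mul1r ?subrK.
Qed.

Let inverse_of_degree n z :=
  exists q, [/\ coefs_in B q, (size q <= n.+1)%N & 1 = pi * q.[z]].

(** Chevalley's elimination step.  A relation of degree [k] for [z^-1]
    expresses [z^k] through lower powers of [z] (its constant term is absorbed
    by [one_sub_unit]); substituting this into the leading term of the relation
    for [z] lowers the degree [n] of the latter. *)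
Lemma lower_inverse_degree n k z : z != 0 -> (k <= n)%N -> (0 < n)%N ->
  inverse_of_degree n z -> inverse_of_degree k z^-1 -> inverse_of_degree n.-1 z.
Proof.
case: n => // n z0 le_kn _ [q [Bq szq qE]] [r [Br szr rE]].
pose c := (1 - pi * r`_0)^-1.
have c0 : 1 - pi * r`_0 != 0.
  apply/eqP => c0; apply: nBpi; suff -> : pi^-1 = r`_0 by [].
  by apply: (mulfI pi0); rewrite divff //; apply/eqP; rewrite -subr_eq0 c0.
pose s := \poly_(j < k) (c * r`_(k - j)).
have Bs : coefs_in B s.
  move=> i; rewrite coef_poly; case: ifP => _; last exact: subring0.
  by apply: subringM => //; exact: one_sub_unit.
have sE : z ^+ k = pi * s.[z].
  apply: (mulfI c0); rewrite mulrBl mul1r.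
  have {1}-> : z ^+ k = pi * \sum_(j < k.+1) r`_(k - j) * z ^+ j.
    rewrite -[LHS]mul1r rE (horner_coef_wide _ szr) -mulrA mulr_suml; congr (_ * _).
    rewrite (reindex_inj rev_ord_inj) /=; apply: eq_bigr => j _.
    rewrite subSS -mulrA; congr (_ * _); rewrite exprVn.
    have -> : z ^+ k = z ^+ j * z ^+ (k - j) by rewrite -exprD subnKC // -ltnS.
    by rewrite mulrCA mulVf ?mulr1 ?expf_neq0.
  rewrite big_ord_recr /= subnn mulrDr [pi * (_ * z ^+ k)]mulrA addrK horner_poly.
  rewrite mulrCA; congr (_ * _); rewrite mulr_sumr; apply: eq_bigr => j _.
  by rewrite -mulrA mulVKf.
exists (q - (q`_(n.+1))%:P * 'X^(n.+1) + (pi * q`_(n.+1))%:P * ('X^(n.+1 - k) * s)); split.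
- apply: coefs_inD => //; first apply: coefs_inB => //.
    by apply: coefs_inM => //; [exact: coefs_inC | exact: coefs_inXn].
  apply: coefs_inM => //; first by apply: coefs_inC => //; exact: subringM.
  by apply: coefs_inM => //; exact: coefs_inXn.
- apply/leq_sizeP => j; rewrite leq_eqVlt => /predU1P[<-|lt_nj].
    rewrite coefD coefB !coefCM coefXn eqxx mulr1 subrr add0r coefXnM.
    by rewrite ltnNge leq_subr /= coef_poly; case: ifP => [|_]; [lia | rewrite mulr0].
  rewrite coefD coefB !coefCM coefXn (gtn_eqF lt_nj) mulr0 subr0 coefXnM.
  have /(nth_default 0)-> : (size q <= j)%N by lia.
  rewrite add0r.
  by case: ifP; rewrite ?mulr0 // => _; rewrite coef_poly; case: ifP => [|_]; [lia | rewrite mulr0].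
- rewrite !(hornerD, hornerN, hornerM, hornerC, hornerXn) [LHS]qE; congr (_ * _).
  have -> : z ^+ n.+1 = z ^+ (n.+1 - k) * z ^+ k by rewrite -exprD subnK.
  by rewrite sE; ring.
Qed.

(** If neither [z] nor [z^-1] were in [B], maximality would write [pi^-1] as a
    polynomial in each of them, and [lower_inverse_degree], applied to
    whichever relation is longer, would descend forever. *)
Lemma maximal_subring_total z : B z \/ B z^-1.
Proof.
apply: contrapT => /not_orP[nBz nBzv].
have z0 : z != 0 by apply/eqP => z0; apply: nBz; rewrite z0; exact: subring0.
have inv w : ~ B w -> exists n, inverse_of_degree n w.
  move=> /adjoin_pi[q Sq qE]; exists (size q), q; split=> //.
  by rewrite -qE divff.
have [n hn] := inv _ nBz; have [k hk] := inv _ nBzv.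
have no0 w : ~ inverse_of_degree 0 w.
  move=> [q [Bq /size1_polyC-> qE]]; apply: nBpi; suff -> : pi^-1 = q`_0 by [].
  by apply: (mulfI pi0); rewrite divff // qE hornerC.
have [N] := ubnP (n + k)%N; elim: N n k hn hk => // N IHN n k hn hk ltN.
case: (leqP k n) => le_kn.
  have n0 : (0 < n)%N by case: n hn {ltN le_kn} => // /no0.
  by apply: (IHN n.-1 k) => //; [apply: lower_inverse_degree hk | lia].
have k0 : (0 < k)%N by lia.
apply: (IHN n k.-1) => //; last by lia.
by apply: (lower_inverse_degree (k := n)); rewrite ?invr_eq0 ?invrK // ltnW.
Qed.

End MaximalSubring.

(** * Units, orders and valuations at a place *)

Section PlaceTheory.

Variables (K F : fieldType) (iota : {rmorphism K -> F}).
Implicit Types (P Q : place iota) (x y z t u : F).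

Local Notation O := valuation_ring.

Lemma place_ext P Q : O P = O Q -> P = Q.
Proof.
case: P Q => [A a1 a2 a3 a4] [B b1 b2 b3 b4] /= eAB; move: b1 b2 b3 b4.
by rewrite -eAB => *; congr Place; exact: Prop_irrelevance.
Qed.

Lemma vr_closed P : subring_closed [pred z | z \in O P].
Proof. by case: P. Qed.

Lemma vr_total P z : O P z \/ O P z^-1.
Proof. by case: P. Qed.

Lemma vr1 P : O P 1.
Proof. exact: subring1 (vr_closed P). Qed.

Lemma vr0 P : O P 0.
Proof. exact: subring0 (vr_closed P). Qed.

Lemma vrN P x : O P x -> O P (- x).
Proof. exact: subringN (vr_closed P) _. Qed.

Lemma vrD P x y : O P x -> O P y -> O P (x + y).
Proof. exact: subringD (vr_closed P) _ _. Qed.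

Lemma vrM P x y : O P x -> O P y -> O P (x * y).
Proof. exact: subringM (vr_closed P) _ _. Qed.

Lemma vrX P x n : O P x -> O P (x ^+ n).
Proof. exact: subringX (vr_closed P) _ _. Qed.

Lemma vr_const P a : O P (iota a).
Proof. by case: P => A ? [/= + _] ? ?; apply; exists a. Qed.

Lemma vr_sum P (I : Type) (r : seq I) (C : pred I) (f : I -> F) :
  (forall i, C i -> O P (f i)) -> O P (\sum_(i <- r | C i) f i).
Proof. exact: subring_sum (vr_closed P) _ _ _ _. Qed.

Lemma vr_prod P (I : Type) (r : seq I) (C : pred I) (f : I -> F) :
  (forall i, C i -> O P (f i)) -> O P (\prod_(i <- r | C i) f i).
Proof. exact: subring_prod (vr_closed P) _ _ _ _. Qed.

Lemma unit_const P a : a != 0 -> valuation_unit P (iota a).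
Proof.
move=> a0; split; first by rewrite fmorph_eq0.
  exact: vr_const.
by rewrite -fmorphV; exact: vr_const.
Qed.

Lemma unit1 P : valuation_unit P 1.
Proof. by rewrite -(rmorph1 iota); apply: unit_const; exact: oner_neq0. Qed.

Lemma unitM P x y :
  valuation_unit P x -> valuation_unit P y -> valuation_unit P (x * y).
Proof.
move=> [x0 Ox Oxv] [y0 Oy Oyv]; split; first by rewrite mulf_neq0.
  exact: vrM.
by rewrite invfM; exact: vrM.
Qed.

Lemma unitV P x : valuation_unit P x -> valuation_unit P x^-1.
Proof. by move=> [x0 Ox Oxv]; split; rewrite ?invr_eq0 ?invrK. Qed.

Lemma unitX P x n : valuation_unit P x -> valuation_unit P (x ^+ n).
Proof.
move=> Ux; elim: n => [|n IHn]; first by rewrite expr0; exact: unit1.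
by rewrite exprS; exact: unitM.
Qed.

Lemma maximal_vr P x : maximal_ideal P x -> O P x.
Proof. by case. Qed.

Lemma maximalE P x : maximal_ideal P x <-> O P x /\ (x = 0 \/ ~ O P x^-1).
Proof.
split=> [[Ox nU]|[Ox h]]; split=> //.
  have [->|x0] := eqVneq x 0; first by left.
  by right=> Oxv; apply: nU.
by case=> x0 _ Oxv; case: h => // x00; rewrite x00 eqxx in x0.
Qed.

Lemma maximalV P x : ~ O P x -> maximal_ideal P x^-1.
Proof.
move=> nOx; apply/maximalE; split; last by right; rewrite invrK.
by case: (vr_total P x).
Qed.

Lemma maximal0 P : maximal_ideal P 0.
Proof. by apply/maximalE; split; [exact: vr0 | left]. Qed.

Lemma maximalM P x y : O P x -> maximal_ideal P y -> maximal_ideal P (x * y).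
Proof.
move=> Ox /maximalE[Oy h]; apply/maximalE; split; first exact: vrM.
have [->|x0] := eqVneq x 0; first by left; rewrite mul0r.
case: h => [->|h]; first by left; rewrite mulr0.
right=> hxy; apply: h; have -> : y^-1 = x * (x * y)^-1.
  by rewrite invfM mulrA divff ?mul1r.
exact: vrM.
Qed.

Lemma maximalD P x y :
  maximal_ideal P x -> maximal_ideal P y -> maximal_ideal P (x + y).
Proof.
have [->|y0] := eqVneq y 0; first by rewrite addr0.
have [->|x0] := eqVneq x 0; first by rewrite add0r.
case: (vr_total P (x / y)) => [Oq Mx My|]; last rewrite invf_div => Oq Mx My.
  rewrite (_ : x + y = (x / y + 1) * y); last by rewrite mulrDl divfK ?mul1r.
  by apply: maximalM => //; apply: vrD => //; exact: vr1.
rewrite (_ : x + y = (1 + y / x) * x); last by rewrite mulrDl divfK ?mul1r.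
by apply: maximalM => //; apply: vrD => //; exact: vr1.
Qed.

Lemma maximal_sum P (I : Type) (r : seq I) (C : pred I) (f : I -> F) :
  (forall i, C i -> maximal_ideal P (f i)) ->
  maximal_ideal P (\sum_(i <- r | C i) f i).
Proof. by move=> Of; apply: big_ind => //; [exact: maximal0|exact: maximalD]. Qed.

Lemma maximal_unit P x : maximal_ideal P x -> valuation_unit P x -> False.
Proof. by case. Qed.

Lemma vr_unitVmax P x : O P x -> valuation_unit P x \/ maximal_ideal P x.
Proof. by move=> Ox; have [?|?] := EM (valuation_unit P x); [left|right]. Qed.

Lemma unitDmaximal P x u :
  valuation_unit P u -> maximal_ideal P x -> valuation_unit P (u + x).
Proof.
move=> Uu Mx; have [//|Mux] := vr_unitVmax (vrD (let: And3 _ h _ := Uu in h) (maximal_vr Mx)).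
case: (@maximal_unit P u) => //; rewrite -[u](addrK x); apply: maximalD => //.
by rewrite -mulN1r; apply: maximalM => //; apply: vrN; exact: vr1.
Qed.

(** Associated elements, that is, elements of equal order at [P].  Working with
    this relation allows orders to be compared before [P] is known to be
    discrete. *)
Definition assoc P x y := valuation_unit P (x / y).

Lemma assoc_neq0 P x y : assoc P x y -> (x != 0) && (y != 0).
Proof. by case; rewrite mulf_eq0 invr_eq0 negb_or. Qed.

Lemma assoc_refl P x : x != 0 -> assoc P x x.
Proof. by move=> x0; rewrite /assoc divff //; exact: unit1. Qed.

Lemma assoc_sym P x y : assoc P x y -> assoc P y x.
Proof. by move=> /unitV; rewrite /assoc invf_div. Qed.

Lemma assocM P x1 y1 x2 y2 :
  assoc P x1 y1 -> assoc P x2 y2 -> assoc P (x1 * x2) (y1 * y2).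
Proof. by move=> h1 h2; rewrite /assoc -mulf_div; exact: unitM. Qed.

Lemma assocV P x y : assoc P x y -> assoc P x^-1 y^-1.
Proof. by move=> /unitV; rewrite /assoc invfM invrK. Qed.

Lemma assocX P x y n : assoc P x y -> assoc P (x ^+ n) (y ^+ n).
Proof. by move=> /(@unitX _ _ n); rewrite /assoc expr_div_n. Qed.

Lemma assocXz P x y (n : int) : assoc P x y -> assoc P (x ^ n) (y ^ n).
Proof. by case: n => n h; [exact: assocX | apply/assocV/assocX]. Qed.

Lemma assoc_trans P y x z : assoc P x y -> assoc P y z -> assoc P x z.
Proof.
move=> h1 h2; have /andP[_ y0] := assoc_neq0 h1.
by move: (unitM h1 h2); rewrite /assoc mulrA divfK.
Qed.

Lemma unit_assoc1 P x : valuation_unit P x -> assoc P x 1.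
Proof. by rewrite /assoc divr1. Qed.

Lemma assoc1_unit P x : assoc P x 1 -> valuation_unit P x.
Proof. by rewrite /assoc divr1. Qed.

Lemma assoc_prod P (I : Type) (r : seq I) (C : pred I) (f g : I -> F) :
  (forall i, C i -> assoc P (f i) (g i)) ->
  assoc P (\prod_(i <- r | C i) f i) (\prod_(i <- r | C i) g i).
Proof.
move=> h; apply: (big_ind2 (assoc P)) => //.
  by apply: assoc_refl; exact: oner_neq0.
by move=> *; exact: assocM.
Qed.

Lemma assoc_vr P x y : assoc P x y -> O P y -> O P x.
Proof.
move=> h Oy; have /andP[_ y0] := assoc_neq0 h.
by rewrite -[x](divfK y0); apply: vrM => //; case: h.
Qed.

(** Integral closedness, for the equations [X^n = a]. *)
Lemma vr_root P x n : (0 < n)%N -> O P (x ^+ n) -> O P x.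
Proof.
case: n => // n _ Oxn; have [//|Oxv] := vr_total P x.
have [->|x0] := eqVneq x 0; first exact: vr0.
rewrite (_ : x = x ^+ n.+1 * x^-1 ^+ n); first exact/vrM/vrX.
by rewrite exprS exprVn mulfK // expf_neq0.
Qed.

(** Equality of orders may be tested on [n]-th powers.  This is what replaces
    ramification indices: for a monomial [z = a(x) y^j], the power [z^m] is a
    rational function of [x]. *)
Lemma assoc_root P x y n :
  (0 < n)%N -> assoc P (x ^+ n) (y ^+ n) -> assoc P x y.
Proof.
move=> n0 h; have /andP[x0 y0] := assoc_neq0 h.
move: h; rewrite /assoc -expr_div_n => -[_ h1 h2]; split.
- by move: x0 y0; rewrite mulf_eq0 invr_eq0 !expf_eq0 n0 /= negb_or => -> ->.
- exact: vr_root h1.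
by apply: (vr_root n0); rewrite exprVn.
Qed.

Section PowersOfElement.

Variables (P : place iota) (t : F).
Hypotheses (t0 : t != 0) (Mt : maximal_ideal P t).

Lemma expz_vr (n : int) : O P (t ^ n) <-> 0 <= n.
Proof.
split; last by case: n => // n _; exact/vrX/maximal_vr.
case: n => // n On; exfalso; have /maximalE[_ [|[]]] := Mt.
  by move/eqP; apply/negP.
by apply: (@vr_root P _ n.+1) => //; rewrite exprVn.
Qed.

Lemma assoc_expz_vr z (n : int) : assoc P z (t ^ n) -> O P z <-> 0 <= n.
Proof.
move=> h; rewrite -expz_vr; split; apply: assoc_vr => //; exact: assoc_sym.
Qed.

Lemma assoc_expz_inj (n k : int) : assoc P (t ^ n) (t ^ k) -> n = k.
Proof.
rewrite /assoc invr_expz -expfzDr // => -[_ /expz_vr h1].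
by rewrite invr_expz => /expz_vr; lia.
Qed.

Hypothesis t_order : forall z, z != 0 -> exists n : int, assoc P z (t ^ n).

Lemma uniformizerP : uniformizer P t.
Proof.
rewrite /uniformizer; apply/seteqP; split=> [z Mz|z [w Ow <-]] /=; last first.
  by rewrite mulrC; exact: maximalM.
have [->|z0] := eqVneq z 0; first by exists 0; rewrite ?mulr0 //; exact: vr0.
have [n zn] := t_order z0; exists (z / t); last by rewrite mulrC divfK.
have zt : assoc P (z / t) (t ^ (n - 1)).
  by rewrite expfzDr // exprN1; apply: assocM => //; apply/assocV/assoc_refl.
apply/(assoc_expz_vr zt).
have /(assoc_expz_vr zn) := maximal_vr Mz; rewrite le_eqVlt => /predU1P[n0|]; last lia.
by case: (maximal_unit Mz); apply: assoc1_unit; move: zn; rewrite -n0 expr0z.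
Qed.

End PowersOfElement.

Lemma vr_proper P : exists z, ~ O P z.
Proof.
by case: P => A ? ? [_ h] ? /=; apply: contra_notP h => /forallNP h z _; apply: contrapT.
Qed.

Lemma uniformizer_maximal P t : uniformizer P t -> maximal_ideal P t.
Proof. by rewrite /uniformizer => ->; exists 1; [exact: vr1 | rewrite mulr1]. Qed.

Lemma uniformizer_neq0 P t : uniformizer P t -> t != 0.
Proof.
move=> Ut; have [z nOz] := vr_proper P; apply/eqP => t0.
have := maximalV nOz; rewrite Ut => -[w _]; rewrite t0 mul0r => /esym/eqP.
by rewrite invr_eq0 => /eqP z0; apply: nOz; rewrite z0; exact: vr0.
Qed.

Lemma uniformizer_assoc P t t' : uniformizer P t -> uniformizer P t' -> assoc P t t'.
Proof.
move=> Ut Ut'; have t0 := uniformizer_neq0 Ut; have t'0 := uniformizer_neq0 Ut'.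
have := uniformizer_maximal Ut; have := uniformizer_maximal Ut'.
rewrite {1}Ut {1}Ut' => -[w Ow tw] [w' Ow' t'w'].
split; first by rewrite mulf_neq0 ?invr_eq0.
  by rewrite -t'w' mulrC mulKf.
by rewrite invf_div -tw mulrC mulKf.
Qed.

Lemma valuationE P t z (n : int) :
  uniformizer P t -> assoc P z (t ^ n) -> valuation P z = n.
Proof.
move=> Ut zn; have t0 := uniformizer_neq0 Ut.
apply: xget_unique => [|k [t' [u [Ut' Uu zE]]]].
  by exists t, (z / t ^ n); split=> //; rewrite mulrC divfK ?expfz_neq0.
apply: (assoc_expz_inj t0 (uniformizer_maximal Ut)).
apply: assoc_trans _ zn.
apply: assoc_trans (assocXz k (uniformizer_assoc Ut Ut')) _.
apply: assoc_sym; rewrite /assoc zE mulrC mulKf // expfz_neq0 //.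
exact: uniformizer_neq0 Ut'.
Qed.

(** The value 0 which the valuation takes by convention, when [z = 0] or when
    [P] has no uniformizer, is compatible with this inequality.  The converse
    depends on discreteness, see [vr_valuationE]. *)
Lemma valuation_ge0 P z : O P z -> 0 <= valuation P z.
Proof.
rewrite /valuation; case: xgetP => // n _ [t [u [Ut Uu zE]]] Oz.
apply/(assoc_expz_vr (uniformizer_neq0 Ut) (uniformizer_maximal Ut) _ : _ <-> _); last exact: Oz.
by rewrite /assoc zE mulrC mulKf // expfz_neq0 // (uniformizer_neq0 Ut).
Qed.

Lemma valuation_gt0 P z : 0 < valuation P z -> maximal_ideal P z.
Proof.
rewrite /valuation; case: xgetP => // n _ [t [u [Ut Uu ->]]] n0.
have -> : t ^ n * u = (t ^ (n - 1) * u) * t.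
  by rewrite mulrAC -[X in _ * X * u]expr1z -expfzDr ?(uniformizer_neq0 Ut) // subrK.
apply: maximalM; last exact: uniformizer_maximal.
apply: vrM; last by case: Uu.
by apply/(expz_vr (uniformizer_neq0 Ut) (uniformizer_maximal Ut)); lia.
Qed.

End PlaceTheory.

(** * Discreteness and existence of places *)

Section PlaceConstructions.

Variables (K F : fieldType) (iota : {rmorphism K -> F}).
Implicit Types (P Q : place iota) (x y z t u : F).

Local Notation O := valuation_ring.

Lemma vr_nonconstant P : exists2 z, O P z & forall a, iota a <> z.
Proof.
case: P => A ? [_ nsub] ? ? /=; apply: contra_notP nsub => /forall2NP h z Az.
have [//|/existsNP[a /contrapT az]] := h z; by exists a.
Qed.

(** Automorphisms over the constants act on places.  Surjectivity of [sigma],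
    in the guise of its right inverse [tau], ensures that the inverse image of
    the valuation ring is neither all of F nor reduced to constants. *)
Lemma pullback_placeP P (sigma : {rmorphism F -> F}) (tau : F -> F) :
  cancel tau sigma -> (forall a, sigma (iota a) = iota a) ->
  exists P' : place iota, forall z, O P' z = O P (sigma z).
Proof.
move=> tauK sigma_const; pose A : set F := [set z | O P (sigma z)].
have A_ring : subring_closed [pred z | z \in A].
  split=> [|x y|x y]; rewrite !inE /A /=.
  - by rewrite rmorph1; exact: vr1.
  - by move=> ? ?; rewrite rmorphB; apply: vrD => //; exact: vrN.
  - by move=> ? ?; rewrite rmorphM; exact: vrM.
have [w nOw] := vr_proper P.
have A_const : range iota `<` A.
  split=> [_ [a _ <-]|]; first by rewrite /A /= sigma_const; exact: vr_const.
  have [z Oz z_nconst] := vr_nonconstant P => sub.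
  have [a _ az] : range iota (tau z) by apply: sub; rewrite /A /= tauK.
  by apply: (z_nconst a); rewrite -[z]tauK -az sigma_const.
have A_proper : A `<` setT.
  split=> // /(_ (tau w) I); by rewrite /A /= tauK.
have A_total z : A z \/ A z^-1 by rewrite /A /= fmorphV; exact: vr_total.
by exists (Place A_ring A_const A_proper A_total).
Qed.

(** The ultrametric inequality is an equality when no two terms have the same
    order: after division by the term of smallest order, all other terms lie
    in the maximal ideal. *)
Lemma dominant_term P (I : finType) (C : pred I) (f : I -> F) :
  (exists i, C i) -> (forall i, C i -> f i != 0) ->
  (forall i j, C i -> C j -> i != j -> ~ assoc P (f i) (f j)) ->
  exists i, [/\ C i, forall j, C j -> O P (f j / f i) &
    assoc P (\sum_(j | C j) f j) (f i)].
Proof.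
move=> [i0 Ci0] f0 f_distinct.
pose r : rel I := fun i j => `[< O P (f i / f j) >].
have r_total : total r.
  move=> i j; case: (vr_total P (f i / f j)) => [h|h]; apply/orP; [left|right].
    exact/asboolP.
  by apply/asboolP; rewrite -invf_div.
have r_trans : {in C & &, transitive r}.
  move=> j i k Cj _ _ /asboolP h1 /asboolP h2; apply/asboolP.
  have -> : f i / f k = (f i / f j) * (f j / f k) by rewrite mulrA divfK ?f0.
  exact: vrM.
have [i [Ci imax]] : exists i, C i /\ forall j, C j -> r j i.
  have [s Cs sC] : exists2 s : seq I, all C s & forall j, C j -> j \in s.
    exists (enum C); last by move=> j; rewrite mem_enum.
    by apply/allP => j; rewrite mem_enum.
  suff /(_ s Cs) [] : forall s, all C s ->
      s = [::] \/ exists i, C i /\ forall j, j \in s -> r j i.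
  - by move=> s0; have := sC _ Ci0; rewrite s0.
  - by move=> [i [Ci h]]; exists i; split=> // j /sC; exact: h.
  elim=> [|k s' IHs] /=; first by left.
  move=> /andP[Ck Cs']; right; case: (IHs Cs') => [->|[i [Ci h]]].
    by exists k; split=> // j; rewrite inE => /eqP->; have /orP[] := r_total k k.
  case/orP: (r_total k i) => ki.
    by exists i; split=> // j; rewrite inE => /predU1P[->//|]; exact: h.
  exists k; split=> // j; rewrite inE => /predU1P[->//|js'].
    by have /orP[] := r_total k k.
  by apply: (r_trans i) ki; rewrite ?unfold_in //; [exact: (allP Cs')|exact: h].
exists i; split=> // [j /imax/asboolP//|].
rewrite (bigD1 i) //= /assoc mulrDl divff ?f0 //; apply: unitDmaximal.
  exact: unit1.
rewrite mulr_suml; apply: maximal_sum => j /andP[Cj ji].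
have /asboolP h := imax _ Cj; case: (vr_unitVmax h) => // /f_distinct h'.
by case: h'.
Qed.

Section Discrete.

Variables (P : place iota) (pi : F) (M : nat).
Hypotheses (pi0 : pi != 0) (Mpi : maximal_ideal P pi) (M_gt0 : (0 < M)%N).
Hypothesis pi_order : forall z, z != 0 -> exists n : int, assoc P (z ^+ M) (pi ^ n).

(** If [M]-th powers have an order with respect to [pi], the order group is
    embedded in (1/M) Z, so it is cyclic: the element whose order is smallest
    among the positive ones generates it, by Euclidean division. *)
Lemma uniformizer_exists :
  exists t, [/\ t != 0, maximal_ideal P t &
    forall z, z != 0 -> exists n : int, assoc P z (t ^ n)].
Proof.
have M0 : (0 < M%:Z) by lia.
pose good n := `[< exists2 t, t != 0 & assoc P (t ^+ M) (pi ^ n.+1%:Z) >].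
have exgood : exists n, good n.
  exists M.-1; apply/asboolP; exists pi => //; rewrite prednK //.
  by apply: assoc_refl; rewrite expf_neq0.
have [n /asboolP[t t0 tn] n_min] := ex_minnP exgood.
exists t; split=> //.
  have Ot : O P t.
    by apply: (vr_root M_gt0); apply: (assoc_vr tn); exact/vrX/maximal_vr.
  case: (vr_unitVmax Ot) => // /(@unitX _ _ _ _ _ M)/unit_assoc1/assoc_sym h.
  by have := assoc_trans h tn; rewrite -(expr0z pi) => /(assoc_expz_inj pi0 Mpi).
move=> z z0; have [k zk] := pi_order z0.
pose q := (k %/ n.+1%:Z)%Z; exists q.
have zq : assoc P ((z / t ^ q) ^+ M) (pi ^ (k %% n.+1%:Z)%Z).
  rewrite /modz expfzDr // exprMn; apply: assocM => //.
  rewrite exprVn -invr_expz; apply/assocV.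
  have -> : (t ^ q) ^+ M = (t ^+ M) ^ q by rewrite exprnP exprz_exp mulrC -exprz_exp.
  by rewrite [(_ %/ _)%Z * _]mulrC -exprz_exp; apply: assocXz.
have zq0 : z / t ^ q != 0 by rewrite mulf_neq0 ?invr_eq0 ?expfz_neq0.
case E : (k %% n.+1%:Z)%Z zq => [[|e]|e] zq.
- by apply/(assoc_root M_gt0); move: zq; rewrite expr0z /assoc divr1 expr_div_n.
- have := n_min e; have := ltz_pmod k (isT : 0 < n.+1%:Z); rewrite E => lt_en.
  have /[swap] /[apply] : good e by apply/asboolP; exists (z / t ^ q).
  by lia.
- by have := modz_ge0 k (isT : n.+1%:Z != 0); rewrite E.
Qed.

Lemma vr_valuation_ge0 z : 0 <= valuation P z -> O P z.
Proof.
have [->|z0] := eqVneq z 0; first by move=> _; exact: vr0.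
have [t [t0 Mt tP]] := uniformizer_exists; have [n zn] := tP _ z0.
by rewrite (valuationE (uniformizerP t0 Mt tP) zn) => /(assoc_expz_vr t0 Mt zn).
Qed.

End Discrete.
End PlaceConstructions.

(** Chevalley's extension theorem for the ring K[pi].  Since K is algebraically
    closed, [pi] is transcendental, so [pi^-1] is not in K[pi]; a subring that
    is maximal for containing K[pi] but not [pi^-1] is a valuation ring by
    [maximal_subring_total]. *)
Lemma place_exists (K : closedFieldType) (F : fieldType)
    (iota : {rmorphism K -> F}) (pi : F) :
  (forall a, pi != iota a) -> exists P : place iota, maximal_ideal P pi.
Proof.
move=> pi_nconst; have pi0 : pi != 0 by rewrite -(rmorph0 iota).
pose ev (q : {poly K}) := (map_poly iota q).[pi].
have evV q : ev q != pi^-1.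
  apply/eqP => qE; pose g := 'X * q - 1.
  have gpi : (map_poly iota g).[pi] = 0.
    rewrite rmorphB rmorphM rmorph1 /= map_polyX !hornerE -[(_).[_]]/(ev q) qE.
    by rewrite divff ?subrr.
  have g0 : g != 0.
    apply/eqP => /(congr1 (fun p : {poly K} => p.[0])).
    by rewrite /g !hornerE => /eqP; rewrite oppr_eq0 oner_eq0.
  have [rs gE] := closed_field_poly_normal g.
  move: gpi; rewrite gE map_polyZ hornerZ /= => /eqP.
  rewrite mulf_eq0 fmorph_eq0 lead_coef_eq0 (negPf g0) /= rmorph_prod horner_prod.
  rewrite prodf_seq_eq0 => /hasP[a _] /=.
  by rewrite rmorphB /= map_polyX map_polyC !hornerE subr_eq0 (negPf (pi_nconst a)).
pose good (B : set F) := [/\ subring_closed [pred z | z \in B],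
  range iota `<=` B, B pi & ~ B pi^-1].
have good0 : good (range ev).
  split.
  - split=> [|x y|x y]; rewrite !inE.
    + by exists 1 => //; rewrite /ev rmorph1 hornerC.
    + by move=> [p _ <-] [q _ <-]; exists (p - q) => //; rewrite /ev rmorphB hornerD hornerN.
    + by move=> [p _ <-] [q _ <-]; exists (p * q) => //; rewrite /ev rmorphM hornerM.
  - by move=> _ [a _ <-]; exists a%:P => //; rewrite /ev map_polyC hornerC.
  - by exists 'X => //; rewrite /ev map_polyX hornerX.
  - by case=> q _ /eqP; rewrite (negPf (evV q)).
(* The empty set is added to the family, as the union of the empty chain. *)
have [|B [B_good B_max]] := @Zorn_bigcup F [set B | B = set0 \/ good B].
  move=> C Cgood Ctot; have [[B0 CB0 gB0]|Cng] := EM (exists2 B, C B & good B); last first.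
    left; apply/seteqP; split=> // z [B CB Bz]; case: (Cgood _ CB) => [B0|gB].
      by move: Bz; rewrite B0.
    by case: Cng; exists B.
  have common x y : (\bigcup_(X in C) X) x -> (\bigcup_(X in C) X) y ->
      exists B, [/\ C B, good B, B x & B y].
    have g1 B w : C B -> B w -> good B.
      by move=> CB Bw; case: (Cgood _ CB) => // B0'; move: Bw; rewrite B0'.
    move=> [X CX Xx] [Y CY Yy]; have [XY|YX] := Ctot _ _ CX CY.
      by exists Y; split=> //; [exact: g1 Yy | exact: XY].
    by exists X; split=> //; [exact: g1 Xx | exact: YX].
  have [B0r B0c B0pi B0n] := gB0.
  right; split.
  - split=> [|x y|x y]; rewrite !inE.
    + by exists B0 => //; exact: subring1.
    + move=> hx hy; have [B [CB [Br _ _ _] Bx By]] := common _ _ hx hy.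
      by exists B => //; exact: subringB.
    + move=> hx hy; have [B [CB [Br _ _ _] Bx By]] := common _ _ hx hy.
      by exists B => //; exact: subringM.
  - by move=> z /B0c; exists B0.
  - by exists B0.
  - by move=> h; have [B [_ [_ _ _ +] + _]] := common _ _ h h.
have {}B_good : good B.
  case: B_good => // B0; case: (B_max (range ev)); last by right.
  rewrite B0; split=> // /(_ (ev 0)); apply; exact: imageT.
have [Br Bc Bpi Bn] := B_good.
have B_max' (C : set F) : subring_closed [pred z | z \in C] -> B `<` C -> C pi^-1.
  move=> C_ring BC; apply: contrapT => nC; apply: (B_max _ BC); right.
  have BC' := properW BC; split=> //; last exact: BC'.
  by move=> z /Bc; exact: BC'.
have B_total := maximal_subring_total Br pi0 Bpi Bn B_max'.
have B_const : range iota `<` B.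
  by split=> // /(_ _ Bpi)[a _ /esym/eqP]; rewrite (negPf (pi_nconst a)).
have B_proper : B `<` setT by split=> // /(_ pi^-1 I).
exists (Place Br B_const B_proper B_total).
by apply/maximalE; split=> //=; right.
Qed.

(** * Places of an extension of K(x) and rational functions *)

Lemma ratfunP (K : fieldType) (c : ratfun K) :
  exists p q : {poly K}, [/\ q != 0, coprimep p q & c = tofrac p / tofrac q].
Proof.
have [p [q [q0 cE]]] : exists p q : {poly K}, q != 0 /\ c = tofrac p / tofrac q.
  elim/quotW: c => u; exists (frac u).1, (frac u).2; split; first exact: denom_ratioP.
  have d0 := denom_ratioP u; apply: (canRL (mulfK _)); first by rewrite tofrac_eq0.
  unlock FracField.tofrac; rewrite -[LHS]FracField.pi_mul; apply/eqmodP.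
  rewrite /= FracField.equivfE /FracField.mulf !numden_Ratio ?(oner_eq0, mulf_neq0) //.
  by rewrite !mulr1 mulrC.
exists (p %/ gcdp p q), (q %/ gcdp p q).
have g0 : gcdp p q != 0 by rewrite gcdp_eq0 negb_and q0 orbT.
split.
- by apply: contra_neq q0 => e; rewrite -(divpK (dvdp_gcdr p q)) e mul0r.
- by rewrite coprimep_div_gcd // q0 orbT.
have pE := divpK (dvdp_gcdl p q); have qE := divpK (dvdp_gcdr p q).
rewrite cE -[in LHS]pE -[X in _ / tofrac X = _]qE !rmorphM -mulf_div divff ?mulr1 //.
by rewrite tofrac_eq0.
Qed.

Definition funfield_poly (K : fieldType) (F : fieldExtType (ratfun K))
  (p : {poly K}) : F := in_alg F (tofrac p).

HB.instance Definition _ (K : fieldType) (F : fieldExtType (ratfun K)) :=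
  GRing.RMorphism.copy (@funfield_poly K F) (in_alg F \o @tofrac {poly K}).

Section FunctionField.

Variables (K : fieldType) (F : fieldExtType (ratfun K)).
Implicit Types (P Q : place (funfield_const F)) (p q : {poly K}) (a b : K).
Implicit Types (z pi : F) (c : ratfun K).

Local Notation O := valuation_ring.
Local Notation fp := (@funfield_poly K F).
Local Notation x := (funfield_x F).

Lemma funfield_poly_eq0 p : (fp p == 0) = (p == 0).
Proof. by rewrite /funfield_poly fmorph_eq0 tofrac_eq0. Qed.

Lemma funfield_polyX : fp 'X = x.
Proof. by []. Qed.

Lemma funfield_polyC a : fp a%:P = funfield_const F a.
Proof. by []. Qed.

Lemma unit_funfield_polyC P a : a != 0 -> valuation_unit P (fp a%:P).
Proof. exact: unit_const. Qed.

Lemma funfield_XsubC a : fp ('X - a%:P) = x - funfield_const F a.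
Proof. by rewrite rmorphB. Qed.

Lemma in_alg_ratfun p q : in_alg F (tofrac p / tofrac q) = fp p / fp q.
Proof. by rewrite /funfield_poly (fmorph_div (in_alg F)). Qed.

Lemma vr_poly P p : O P x -> O P (fp p).
Proof.
move=> Ox; elim/poly_ind: p => [|p a IHp]; first by rewrite rmorph0; exact: vr0.
rewrite rmorphD rmorphM; apply: vrD; first exact: vrM.
exact: vr_const.
Qed.

Lemma over_finite_vr P b : maximal_ideal P (fp ('X - b%:P)) -> O P x.
Proof.
move=> /maximal_vr Ob; have -> : x = fp ('X - b%:P) + fp b%:P by rewrite -rmorphD subrK.
by apply: vrD => //; exact: vr_const.
Qed.

(** Taylor expansion at [b]: [p] differs from the constant [p(b)] by a multiple
    of [x - b]. *)
Lemma unit_funfield_poly P b p :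
  maximal_ideal P (fp ('X - b%:P)) -> p.[b] != 0 -> valuation_unit P (fp p).
Proof.
move=> Mb pb0; have /factor_theorem[q pE] : root (p - (p.[b])%:P) b.
  by rewrite rootE !hornerE subrr.
rewrite -[p](subrK (p.[b])%:P) pE rmorphD rmorphM addrC; apply: unitDmaximal.
  exact: unit_const.
by apply: maximalM => //; apply: vr_poly; exact: over_finite_vr Mb.
Qed.

(** The exponent does not depend on [P].  This uniformity is what makes the
    place over a totally ramified point unique in [over_branch_unique]. *)
Lemma poly_at_finite b p : p != 0 -> exists n : nat,
  forall P, maximal_ideal P (fp ('X - b%:P)) ->
    assoc P (fp p) (fp ('X - b%:P) ^+ n).
Proof.
move=> p0; have [n [q /implyP/(_ p0) qb ->]] := multiplicity_XsubC p b.
exists n => P Mb; rewrite rmorphM rmorphXn -[X in assoc _ _ X]mul1r; apply: assocM.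
  by apply: unit_assoc1; exact: unit_funfield_poly Mb qb.
by apply: assoc_refl; rewrite expf_neq0 // funfield_poly_eq0 polyXsubC_eq0.
Qed.

Lemma ratfun_at_finite b c : c != 0 -> exists n : int,
  forall P, maximal_ideal P (fp ('X - b%:P)) ->
    assoc P (in_alg F c) (fp ('X - b%:P) ^ n).
Proof.
move=> c0; have [p [q [q0 _ cE]]] := ratfunP c.
have p0 : p != 0 by apply: contra_neq c0 => p0; rewrite cE p0 rmorph0 mul0r.
have [n1 h1] := poly_at_finite b p0; have [n2 h2] := poly_at_finite b q0.
exists (n1%:Z - n2%:Z) => P Mb; rewrite cE in_alg_ratfun expfzDr; last first.
  by rewrite funfield_poly_eq0 polyXsubC_eq0.
by rewrite -invr_expz; apply: assocM; [exact: h1|apply: assocV; exact: h2].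
Qed.

Lemma x_neq0 : x != 0.
Proof. by rewrite -funfield_polyX funfield_poly_eq0 polyX_eq0. Qed.

Lemma poly_at_infinity P p : ~ O P x -> p != 0 -> assoc P (fp p) (x ^+ (size p).-1).
Proof.
move=> nOx; elim/poly_ind: p => [|p a IHp]; first by rewrite eqxx.
move=> pa0; have [p0|p0] := eqVneq p 0.
  move: pa0; rewrite p0 mul0r add0r polyC_eq0 => a0.
  by rewrite size_polyC a0; apply: unit_assoc1; exact: unit_const.
rewrite size_MXaddC (negPf p0) /=.
have xp0 : x ^+ size p != 0 by rewrite expf_neq0 // x_neq0.
rewrite /assoc rmorphD rmorphM mulrDl; apply: unitDmaximal.
  rewrite -[valuation_unit _ _]/(assoc _ _ _) polySpred // exprSr.
  by apply: assocM; [exact: IHp | apply: assoc_refl; exact: x_neq0].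
apply: maximalM; first exact: vr_const.
rewrite polySpred // exprS invfM mulrC; apply: maximalM; last exact: maximalV.
by rewrite -exprVn; apply: vrX; apply: maximal_vr; exact: maximalV.
Qed.

(** An element [pi] whose powers measure the orders of all rational functions;
    [x - b] and [1 / x] are such elements at the places over [b] and over
    infinity.  It need not be a uniformizer. *)
Definition rational_parameter P pi := [/\ pi != 0, maximal_ideal P pi &
  forall c, c != 0 -> exists n : int, assoc P (in_alg F c) (pi ^ n)].

Lemma finite_parameter P b : maximal_ideal P (fp ('X - b%:P)) ->
  rational_parameter P (fp ('X - b%:P)).
Proof.
move=> Mb; have pi0 : fp ('X - b%:P) != 0 by rewrite funfield_poly_eq0 polyXsubC_eq0.
split=> // c c0; have [n h] := ratfun_at_finite b c0; exists n; exact: h.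
Qed.

Lemma infinite_parameter P : ~ O P x -> rational_parameter P x^-1.
Proof.
move=> nOx; have x0 := x_neq0; split; [by rewrite invr_eq0 | exact: maximalV|].
move=> c c0; have [p [q [q0 _ cE]]] := ratfunP c.
have p0 : p != 0 by apply: contra_neq c0 => p0; rewrite cE p0 rmorph0 mul0r.
exists ((size q).-1%:Z - (size p).-1%:Z); rewrite cE in_alg_ratfun.
rewrite exprz_inv opprB expfzDr // -invr_expz.
by apply: assocM; [|apply: assocV]; exact: poly_at_infinity.
Qed.

(** In the minimal equation of [z] over K(x) two terms must have the same
    order, or else [dominant_term] would make the sum nonzero.  Comparing them
    expresses [z^(j - i)] by a rational function, up to a unit, and [j - i],
    being at most the degree of F, divides its factorial. *)
Lemma power_order P pi : rational_parameter P pi ->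
  forall z, z != 0 -> exists n : int, assoc P (z ^+ (\dim {:F})`!) (pi ^ n).
Proof.
move=> [pi0 Mpi pi_order] z z0; pose q := minPoly 1 z.
have q_alg i : exists c, q`_i = in_alg F c.
  by have /polyOverP/(_ i)/vlineP[c ->] := minPolyOver 1 z; exists c.
have sz_q : (size q <= (\dim {:F}).+1)%N.
  rewrite size_minPoly ltnS.
  have := dim_Fadjoin 1 z; rewrite dimv1 muln1 => <-.
  by rewrite dimvS // subvf.
have term_order i : q`_i != 0 -> exists n, assoc P (q`_i) (pi ^ n).
  by have [c ->] := q_alg i; rewrite fmorph_eq0; exact: pi_order.
have q_lead : q`_(size q).-1 = 1 by apply/monicP; exact: monic_minPoly.
have sz0 : (0 < size q)%N by rewrite size_minPoly.
pose f (i : 'I_(size q)) := q`_i * z ^+ i.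
pose C : pred 'I_(size q) := fun i => q`_i != 0.
have [//|no_pair] := EM (exists n : int, assoc P (z ^+ (\dim {:F})`!) (pi ^ n)).
have lt_q : ((size q).-1 < size q)%N by rewrite prednK.
have [||i j Ci Cj ij fij|i [Ci _ /assoc_neq0/andP[/negP[]]]] :=
  @dominant_term _ _ _ P _ C f.
- by exists (Ordinal lt_q); rewrite /C /= q_lead oner_neq0.
- by move=> i Ci; rewrite mulf_neq0 ?expf_neq0.
- case: no_pair; wlog lt_ij : i j Ci Cj ij fij / (i < j)%N.
    move=> h; case: (ltngtP i j) => [lt|lt|/ord_inj e].
    + exact: (h i j).
    + by apply: (h j i) => //; [rewrite eq_sym | exact: assoc_sym].
    + by rewrite e eqxx in ij.
  have [n1 h1] := term_order i Ci; have [n2 h2] := term_order j Cj.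
  have h : assoc P (z ^+ (j - i)) (pi ^ (n1 - n2)).
    have -> : z ^+ (j - i) = (q`_i / q`_j) * (f j / f i).
      have zj : z ^+ j = z ^+ (j - i) * z ^+ i by rewrite -exprD subnK // ltnW.
      rewrite /f zj.
      by field; apply/and3P; split; rewrite // expf_neq0.
    rewrite expfzDr // -[X in assoc _ _ X]mulr1 -invr_expz; apply: assocM.
      by apply: assocM => //; exact: assocV.
    by apply: unit_assoc1; exact: assoc_sym fij.
  have dv : (j - i %| (\dim {:F})`!)%N.
    by apply: dvdn_fact; have := ltn_ord j; lia.
  exists ((n1 - n2) * ((\dim {:F})`! %/ (j - i))%N).
  by rewrite -{1}(divnK dv) mulnC exprM -exprz_exp; exact: assocX.
- have -> : \sum_(j | C j) f j = q.[z].
    rewrite horner_coef [RHS](bigID C) /= [X in _ + X]big1 ?addr0 // => j.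
    by rewrite negbK => /eqP->; rewrite mul0r.
  exact: root_minPoly.
Qed.

Lemma parameter_vr P pi z : rational_parameter P pi -> 0 <= valuation P z -> O P z.
Proof.
move=> pi_par; have [pi0 Mpi _] := pi_par.
exact: (vr_valuation_ge0 pi0 Mpi (fact_gt0 _) (power_order pi_par)).
Qed.

End FunctionField.

(** * Divisors supported on finitely many points of the line *)

Lemma prod_exprz (F : fieldType) (I : finType) (C : pred I) (z : F) (e : I -> int) :
  z != 0 -> \prod_(i | C i) z ^ e i = z ^ (\sum_(i | C i) e i).
Proof.
move=> z0; rewrite (big_morph (exprz z) (id1 := 1) (op1 := *%R)) // => ? ?.
by rewrite expfzDr.
Qed.

Lemma prod_exprz_neq0 (F : fieldType) (I : finType) (f : I -> F) (e : I -> int) :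
  (forall i, f i != 0) -> \prod_i f i ^ e i != 0.
Proof. by move=> f0; apply/prodf_neq0 => i _; rewrite expfz_neq0. Qed.

Lemma rmorph_prod_exprz (E F : fieldType) (phi : {rmorphism E -> F}) (I : finType)
    (f : I -> E) (e : I -> int) :
  phi (\prod_i f i ^ e i) = \prod_i phi (f i) ^ e i.
Proof. by rewrite rmorph_prod; apply: eq_bigr => i _; rewrite fmorphXz. Qed.

Lemma fmorph_divK (E F : fieldType) (phi : {rmorphism E -> F}) (a b : E) :
  b != 0 -> phi a = phi b * phi (a / b).
Proof. by move=> b0; rewrite -rmorphM mulrC divfK. Qed.

Section ClosedConstants.

Variables (K : closedFieldType) (F : fieldExtType (ratfun K)).
Implicit Types (P Q : place (funfield_const F)) (p q : {poly K}) (a b : K).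
Implicit Types (z pi : F) (c : ratfun K).

Local Notation O := valuation_ring.
Local Notation fp := (@funfield_poly K F).
Local Notation x := (funfield_x F).

Lemma place_over_finite b : exists P, maximal_ideal P (fp ('X - b%:P)).
Proof.
apply: place_exists => a; rewrite -funfield_polyC -subr_eq0 -rmorphB funfield_poly_eq0.
by rewrite -addrA -opprD -polyCD polyXsubC_eq0.
Qed.

Lemma place_over_infinity : exists P, ~ O P x.
Proof.
have [|P /maximalE[_ h]] := @place_exists K F (funfield_const F) x^-1.
  move=> a; apply/eqP => xa; have x0 := x_neq0 F.
  have : x * fp a%:P == 1 by rewrite funfield_polyC -xa divff.
  rewrite -funfield_polyX -rmorphM -subr_eq0 -(rmorph1 fp) -rmorphB funfield_poly_eq0.
  move/eqP/(congr1 (fun p => p.[0])); rewrite !hornerE => /eqP.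
  by rewrite oppr_eq0 oner_eq0.
exists P; case: h => [/eqP|]; last by rewrite invrK.
by rewrite invr_eq0 (negPf (x_neq0 F)).
Qed.

(** If [x] is regular at [P] but no [x - b] vanishes there, then every nonzero
    polynomial is a unit at [P], so K(x) is contained in the valuation ring;
    F being algebraic over K(x), so is F, which is absurd. *)
Lemma place_dichotomy P : (exists b, maximal_ideal P (fp ('X - b%:P))) \/ ~ O P x.
Proof.
have [[b Mb]|noM] := EM (exists b, maximal_ideal P (fp ('X - b%:P))); first by left; exists b.
right=> Ox.
have lin_unit b : valuation_unit P (fp ('X - b%:P)).
  have [//|Mb] := vr_unitVmax (vr_poly ('X - b%:P) Ox).
  by case: noM; exists b.
have nonzero_unit p : p != 0 -> valuation_unit P (fp p).
  move=> p0; have [rs pE] := closed_field_poly_normal p.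
  rewrite pE -mul_polyC rmorphM rmorph_prod; apply: unitM.
    by apply: unit_funfield_polyC; rewrite lead_coef_eq0.
  by apply: big_ind => [|u v|b _]; [exact: unit1 | exact: unitM | exact: lin_unit].
have rat_vr c : O P (in_alg F c).
  have [p [q [q0 _ ->]]] := ratfunP c; rewrite in_alg_ratfun.
  by apply: vrM; [exact: vr_poly | case: (nonzero_unit q q0)].
have [z nOz] := vr_proper P; apply: nOz.
have [//|Ozv] := vr_total P z.
have [->|z0] := eqVneq z 0; first exact: vr0.
pose q := minPoly 1 z; have q_mon : q \is monic := monic_minPoly 1 z.
have : q.[z] = 0 by apply/eqP; exact: root_minPoly.
have szq : size q = (adjoin_degree 1 z).-1.+2.
  by rewrite size_minPoly prednK // adjoin_degree_gt0.
rewrite horner_coef szq big_ord_recr /=.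
have -> : q`_(adjoin_degree 1 z).-1.+1 = 1 by move/monicP: q_mon; rewrite lead_coefE szq.
set d := _.-1; rewrite mul1r => /eqP; rewrite addrC addr_eq0 => /eqP zd.
have -> : z = - \sum_(i < d.+1) q`_i * z^-1 ^+ (d - i).
  apply: (mulIf (expf_neq0 d z0)); rewrite -exprS zd mulNr mulr_suml; congr (- _).
  apply: eq_bigr => i _; rewrite -mulrA exprVn; congr (_ * _).
  have -> : z ^+ d = z ^+ (d - i) * z ^+ i by rewrite -exprD subnK // -ltnS.
  by rewrite mulKf ?expf_neq0.
apply: vrN; apply: vr_sum => i _; apply: vrM; last exact: vrX.
by have /polyOverP/(_ i)/vlineP[c ->] := minPolyOver 1 z; exact: rat_vr.
Qed.

Lemma vr_valuationE P z : O P z <-> 0 <= valuation P z.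
Proof.
split; first exact: valuation_ge0.
case: (place_dichotomy P) => [[b Mb]|nOx].
  exact: parameter_vr (finite_parameter Mb).
exact: parameter_vr (infinite_parameter nOx).
Qed.

Section LinearFactors.

Variables (r : nat) (alpha : 'I_r -> K).
Hypothesis alpha_inj : injective alpha.
Implicit Types (e n : 'I_r -> int).

Definition linear_factor k := fp ('X - (alpha k)%:P).
Local Notation pi := linear_factor.

Lemma linear_factor_neq0 k : pi k != 0.
Proof. by rewrite funfield_poly_eq0 polyXsubC_eq0. Qed.

Lemma prod_linear_mul (m : nat) (c n : 'I_r -> int) :
  (\prod_k pi k ^ c k) ^+ m * \prod_k pi k ^ n k = \prod_k pi k ^ (m%:Z * c k + n k).
Proof.
rewrite -prodrXl -big_split /=; apply: eq_bigr => k _.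
by rewrite expfzDr ?linear_factor_neq0 // exprnP exprz_exp mulrC [m%:Z * _]mulrC mulrC.
Qed.

Lemma linear_factor_unit P b k :
  maximal_ideal P (fp ('X - b%:P)) -> alpha k != b -> valuation_unit P (pi k).
Proof.
move=> Mb kb; rewrite /linear_factor; apply: (unit_funfield_poly Mb).
by rewrite !hornerE subr_eq0 eq_sym.
Qed.

Lemma prod_linear_at_finite P b e : maximal_ideal P (fp ('X - b%:P)) ->
  assoc P (\prod_k pi k ^ e k)
    (fp ('X - b%:P) ^ (\sum_(k | alpha k == b) e k)).
Proof.
move=> Mb; rewrite (bigID (fun k => alpha k == b)) /= -[X in assoc _ _ X]mulr1.
apply: assocM.
  rewrite -prod_exprz ?funfield_poly_eq0 ?polyXsubC_eq0 //.
  apply: assoc_prod => k /eqP <-; apply: assoc_refl.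
  by rewrite expfz_neq0 // linear_factor_neq0.
have prod1 : \prod_(k | alpha k != b) (1 : F) = 1 by rewrite big1_eq.
rewrite -[X in assoc _ _ X]prod1.
apply: assoc_prod => k kb; rewrite -[X in assoc _ _ X](exp1rz F (e k)); apply: assocXz.
by apply: unit_assoc1; exact: linear_factor_unit Mb kb.
Qed.

Lemma prod_linear_at_infinity P e : ~ O P x ->
  assoc P (\prod_k pi k ^ e k) (x ^ (\sum_k e k)).
Proof.
move=> nOx; rewrite -prod_exprz ?x_neq0 //; apply: assoc_prod => k _.
apply: assocXz; rewrite -[x]expr1.
have -> : 1%N = (size ('X - (alpha k)%:P)).-1 by rewrite size_XsubC.
by apply: poly_at_infinity => //; rewrite polyXsubC_eq0.
Qed.

Lemma assoc_infinity_vr P z (N : int) : ~ O P x -> assoc P z (x ^ N) -> O P z <-> N <= 0.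
Proof.
move=> nOx zN; have [t0 Mt _] := infinite_parameter nOx.
rewrite (@assoc_expz_vr _ _ _ P _ t0 Mt z (- N)); first by split; lia.
by rewrite exprz_inv opprK.
Qed.

(** The product formula on the projective line, in the form of an inequality.
    Dividing [c] by the product of the [(x - alpha_k)^(e_k)] leaves a rational
    function whose order at each point is greater than -1: a pole
    would contribute at least [- m] to the order of the first product, and
    [m e_k + n_k < m] forbids the factor [x - alpha_k] to compensate for it.
    The quotient is therefore a polynomial, of nonnegative degree, and its
    degree is bounded by the condition at infinity. *)
Lemma degree_bound (m : nat) c (n n' e : 'I_r -> int) :
  (0 < m)%N -> c != 0 ->
  (forall b P, maximal_ideal P (fp ('X - b%:P)) ->
     O P (in_alg F c ^+ m * \prod_k pi k ^ n k)) ->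
  (forall P, ~ O P x -> O P (in_alg F c ^+ m * \prod_k pi k ^ n' k)) ->
  (forall k, m%:Z * e k + n k < m%:Z) ->
  m%:Z * \sum_k e k + \sum_k n' k <= 0.
Proof.
move=> m0 c0 c_fin c_inf e_lt.
pose g : ratfun K := \prod_k tofrac ('X - (alpha k)%:P) ^ e k.
have g0 : g != 0.
  by apply: prod_exprz_neq0 => k; rewrite tofrac_eq0 polyXsubC_eq0.
have gE : in_alg F g = \prod_k pi k ^ e k.
  rewrite /g (rmorph_prod_exprz (in_alg F)).
  by apply: eq_bigr => k _; rewrite /linear_factor /funfield_poly.
have [p [q [q0 pq cg]]] := ratfunP (c / g).
have cE : in_alg F c = \prod_k pi k ^ e k * (fp p / fp q).
  have -> : in_alg F c = in_alg F g * in_alg F (c / g) := fmorph_divK (in_alg F) c g0.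
  by rewrite gE cg in_alg_ratfun.
have p0 : p != 0.
  apply/eqP => p0; move/eqP: cE.
  by rewrite p0 rmorph0 mul0r mulr0 fmorph_eq0 (negPf c0).
have fq0 : fp q != 0 by rewrite funfield_poly_eq0.
have powE s : in_alg F c ^+ m * \prod_k pi k ^ s k =
    \prod_k pi k ^ (m%:Z * e k + s k) * (fp p / fp q) ^+ m.
  by rewrite cE exprMn mulrAC prod_linear_mul.
(* A root b of the reduced denominator would give a pole at a place over b. *)
have /size_poly1P[u u0 qE] : size q == 1.
  apply: contraT => /closed_rootP[b qb].
  have pb : p.[b] != 0 by apply: (coprimep_root _ qb); rewrite coprimep_sym.
  have /factor_theorem[q' q'E] := qb; have [P Mb] := place_over_finite b.
  have [pib0 _ _] := finite_parameter Mb.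
  have Oq' : O P (fp q') by apply: vr_poly; exact: over_finite_vr Mb.
  have := vrM (c_fin b P Mb) (vrX m Oq'); rewrite powE.
  set E := (X in O P X).
  have : assoc P E (fp ('X - b%:P) ^ (\sum_(k | alpha k == b) (m%:Z * e k + n k) - m%:Z)).
    have -> : E = \prod_k pi k ^ (m%:Z * e k + n k) * (fp p ^+ m * fp ('X - b%:P) ^- m).
      rewrite /E -mulrA; congr (_ * _); rewrite -!exprVn -!exprMn; congr (_ ^+ _).
      move: fq0; rewrite q'E rmorphM mulf_eq0 negb_or => /andP[q'0 _].
      by field; rewrite q'0 andbT -rmorphB.
    rewrite expfzDr //; apply: assocM; first exact: prod_linear_at_finite.
    rewrite -[X in assoc _ _ X]mul1r; apply: assocM.
      by apply: unit_assoc1; apply: unitX; exact: unit_funfield_poly Mb pb.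
    by rewrite exprnN; apply: assoc_refl; rewrite expfz_neq0.
  move=> /(assoc_expz_vr pib0 Mb) -> ; rewrite subr_ge0 leNgt => /negP[].
  have [k kb|nk] := pickP (fun k => alpha k == b); last by rewrite big_pred0.
  rewrite (bigD1 k) //= big1 ?addr0 // => j /andP[/eqP jb].
  by rewrite -(inj_eq alpha_inj) jb (eqP kb) eqxx.
have [P nOx] := place_over_infinity; have := c_inf P nOx; rewrite powE.
have h : assoc P (\prod_k pi k ^ (m%:Z * e k + n' k) * (fp p / fp q) ^+ m)
    (x ^ (\sum_k (m%:Z * e k + n' k) + (size p).-1%:Z * m%:Z)).
  rewrite expfzDr ?x_neq0 //; apply: assocM; first exact: prod_linear_at_infinity.
  rewrite -exprz_exp; apply: assocX; rewrite -[X in assoc _ _ X]mulr1.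
  apply: assocM; first exact: poly_at_infinity.
  rewrite -invr1; apply: assocV; apply: unit_assoc1; rewrite qE.
  exact: unit_const.
move/(assoc_infinity_vr nOx h).
by rewrite big_split /= -mulr_sumr; apply: le_trans; rewrite lerDl mulr_ge0.
Qed.

End LinearFactors.
End ClosedConstants.

(** * The curve y^m = prod_k (x - alpha_k)^(lam_k) *)

Lemma exprzX_prod (F : fieldType) (I : finType) (f : I -> F) (e : I -> nat) (N : int) :
  (\prod_i f i ^+ e i) ^ N = \prod_i f i ^ (N * e i).
Proof.
rewrite (big_morph (fun z => z ^ N) (id1 := 1) (op1 := *%R)) ?exp1rz //; last first.
  by move=> a b; rewrite expfzMl.
by apply: eq_bigr => k _; rewrite exprnP exprz_exp mulrC.
Qed.

Lemma exprzX (F : fieldType) (w : F) (N : int) (n : nat) : (w ^ N) ^+ n = (w ^+ n) ^ N.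
Proof. by rewrite !exprnP !exprz_exp mulrC. Qed.

Section Curve.

Variables (K : closedFieldType) (r : nat) (alpha : 'I_r -> K).
Variables (m : nat) (lam : 'I_r -> nat) (F : fieldExtType (ratfun K)) (y : F).
Hypotheses (alpha_inj : injective alpha) (m_gt0 : (0 < m)%N).
Hypothesis Fgen : <<1; y>>%VS = {:F}%VS.

Local Notation O := valuation_ring.
Local Notation fp := (@funfield_poly K F).
Local Notation x := (funfield_x F).
Local Notation pi := (linear_factor F alpha).

Hypothesis curve : y ^+ m = \prod_k pi k ^+ lam k.

Implicit Types (P Q : place (funfield_const F)) (z : F) (c : 'I_m -> ratfun K).

Lemma y_neq0 : y != 0.
Proof.
have : y ^+ m != 0.
  rewrite curve; apply/prodf_neq0 => k _.
  by rewrite expf_neq0 // linear_factor_neq0.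
by rewrite expf_eq0 m_gt0.
Qed.

Lemma y_exprz (N : int) : (y ^ N) ^+ m = \prod_k pi k ^ (N * lam k).
Proof. by rewrite exprzX curve exprzX_prod. Qed.

Definition combination c : F := \sum_(j < m) in_alg F (c j) * y ^+ j.

Lemma in_alg_1 (a : ratfun K) : in_alg F a \in 1%VS.
Proof. by apply/vlineP; exists a. Qed.

Lemma ym_1 : y ^+ m \in 1%VS.
Proof.
rewrite curve; have -> : \prod_k pi k ^+ lam k = fp (\prod_k ('X - (alpha k)%:P) ^+ lam k).
  by rewrite rmorph_prod; apply: eq_bigr => k _; rewrite rmorphXn.
exact: in_alg_1.
Qed.

Lemma Xm_over : 'X^m - (y ^+ m)%:P \is a polyOver 1%VS.
Proof. by rewrite rpredB ?rpredX ?polyOverX // polyOverC; exact: ym_1. Qed.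

Lemma minPoly_dvd_Xm : minPoly 1 y %| 'X^m - (y ^+ m)%:P.
Proof. by apply: minPoly_dvdp; [exact: Xm_over | rewrite rootE !hornerE subrr]. Qed.

(** The minimal polynomial of [y] divides the equation of the curve, so the
    powers [y^j] with [j < m] span F. *)
Lemma combinationP z : exists c, z = combination c.
Proof.
have szy : (adjoin_degree 1 y <= m)%N.
  have szX : size ('X^m - (y ^+ m)%:P) = m.+1 by exact: size_XnsubC.
  have := dvdp_leq _ minPoly_dvd_Xm; rewrite -size_poly_eq0 szX => /(_ isT).
  by rewrite size_minPoly ltnS.
have zy : z \in <<1; y>>%VS by rewrite Fgen memvf.
have q_alg i : exists a, (Fadjoin_poly 1 y z)`_i = in_alg F a.
  by have /polyOverP/(_ i)/vlineP[a ->] := Fadjoin_polyOver 1 y z; exists a.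
have [c cE] := choice q_alg.
exists (fun j => c j); rewrite -[LHS](Fadjoin_poly_eq zy).
rewrite (@horner_coef_wide _ m) ?(leq_trans (size_Fadjoin_poly _ _ _)) //.
by apply: eq_bigr => j _; rewrite cE.
Qed.

Lemma combination0 c : (forall j, c j = 0) -> combination c = 0.
Proof. by move=> c0; rewrite /combination big1 // => j _; rewrite c0 rmorph0 mul0r. Qed.

Lemma combination_neq0 c : combination c != 0 -> exists j, c j != 0.
Proof.
move=> c_n0; apply: contrapT => nc; move/eqP: c_n0; apply; apply: combination0 => j.
by apply/eqP; apply: contra_notT nc => cj; exists j.
Qed.

Section TotallyRamified.

Variable l : 'I_r.
Hypothesis lam_coprime : coprime m (lam l).

Definition over_branch P := maximal_ideal P (pi l).

Let pi0 : pi l != 0.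
Proof. exact: linear_factor_neq0. Qed.

Lemma curve_over_branch P : over_branch P -> assoc P (y ^+ m) (pi l ^+ lam l).
Proof.
move=> Ml; have -> : y ^+ m = \prod_k pi k ^ (lam k)%:Z by rewrite curve.
have sumE : \sum_(k | alpha k == alpha l) (lam k)%:Z = lam l.
  rewrite (eq_bigl (pred1 l)) ?big_pred1_eq // => k.
  by rewrite /= (inj_eq alpha_inj).
by have := prod_linear_at_finite alpha (fun k => (lam k)%:Z) Ml; rewrite sumE.
Qed.

(** [n j] is [m] times the order of [a_j(x) y^j], measured by [x - alpha_l];
    it is required to be the same at all places over [alpha_l]. *)
Definition term_order c (n : 'I_m -> int) := forall j, c j != 0 ->
  (forall P, over_branch P ->
    assoc P ((in_alg F (c j) * y ^+ j) ^+ m) (pi l ^ n j)) /\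
  exists k : int, n j = m%:Z * k + j%:Z * (lam l)%:Z.

Lemma term_orderP c : exists n, term_order c n.
Proof.
have h j : exists nj : int, c j != 0 ->
  (forall P, over_branch P ->
    assoc P ((in_alg F (c j) * y ^+ j) ^+ m) (pi l ^ nj)) /\
  exists k : int, nj = m%:Z * k + j%:Z * (lam l)%:Z.
  have [->|cj0] := eqVneq (c j) 0; first by exists 0.
  have [k hk] := ratfun_at_finite F (alpha l) cj0.
  exists (k * m%:Z + (lam l)%:Z * j%:Z) => _; split; last by exists k; ring.
  move=> P Ml; rewrite exprMn expfzDr //; apply: assocM.
    by rewrite -exprz_exp; apply: assocX; exact: hk.
  by rewrite exprAC -exprz_exp; apply: assocX; exact: curve_over_branch.
by have [n hn] := choice h; exists n.
Qed.

(** This is where total ramification enters: [n j] is congruent to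
    [j lam_l] modulo [m], and [lam_l] is invertible modulo [m]. *)
Lemma term_order_inj c n i j : term_order c n -> c i != 0 -> c j != 0 ->
  n i = n j -> i = j.
Proof.
move=> cn ci cj nij; have [_ [ki nI]] := cn i ci; have [_ [kj nJ]] := cn j cj.
have dv : (m%:Z %| (i%:Z - j%:Z) * (lam l)%:Z)%Z.
  apply/dvdzP; exists (kj - ki); rewrite mulrBl.
  move: nI nJ; rewrite nij => ->.
  set a := _ * (lam l)%:Z; set b := _ * (lam l)%:Z; rewrite mulrBl ![_ * m%:Z]mulrC; lia.
move: dv; rewrite Gauss_dvdzl // => /dvdzP[q qE].
have lt_i := ltn_ord i; have lt_j := ltn_ord j; apply: val_inj => /=.
have q0 : q = 0 by nia.
by move: qE; rewrite q0 mul0r; lia.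
Qed.

Lemma combination_order c n : term_order c n -> (exists j, c j != 0) ->
  forall P, over_branch P ->
  exists i, [/\ c i != 0, forall j, c j != 0 -> n i <= n j &
    assoc P (combination c ^+ m) (pi l ^ n i)].
Proof.
move=> cn cn0 P Ml.
pose f (j : 'I_m) := in_alg F (c j) * y ^+ j.
have cE : combination c = \sum_(j | c j != 0) f j.
  rewrite /combination (bigID (fun j => c j != 0)) /= [X in _ + X]big1 ?addr0 // => j.
  by rewrite negbK => /eqP->; rewrite scale0r mul0r.
have f0 i : c i != 0 -> f i != 0.
  by move=> ci; rewrite mulf_neq0 ?expf_neq0 ?y_neq0 // fmorph_eq0.
have f_distinct i j : c i != 0 -> c j != 0 -> i != j -> ~ assoc P (f i) (f j).
  move=> ci cj ij fij; have [/(_ P Ml) hi _] := cn i ci; have [/(_ P Ml) hj _] := cn j cj.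
  move/negP: ij; apply; apply/eqP/(term_order_inj cn ci cj).
  apply: (assoc_expz_inj pi0 Ml).
  by apply: assoc_trans hj; apply: assoc_trans (assoc_sym hi) _; exact: assocX.
have [i [ci fi fsum]] := dominant_term cn0 f0 f_distinct.
have [/(_ P Ml) hi _] := cn i ci.
exists i; split=> // [j cj|].
  have [/(_ P Ml) hj _] := cn j cj; rewrite -subr_ge0.
  have : assoc P ((f j / f i) ^+ m) (pi l ^ (n j - n i)).
    by rewrite expfzDr // -invr_expz expr_div_n; apply: assocM => //; exact: assocV.
  by move=> /(assoc_expz_vr pi0 Ml) <-; exact: vrX (fi j cj).
by apply: assoc_trans hi; rewrite cE; exact: assocX.
Qed.

(** A nonzero combination has an order, hence does not vanish: the mere
    existence of a place over [alpha_l] shows that F has degree [m] over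
    K(x). *)
Lemma combination_eq0 c Q : over_branch Q -> combination c = 0 -> forall j, c j = 0.
Proof.
move=> MQ c0 j; apply: contra_eq c0 => cj0.
have [n cn] := term_orderP c.
have cn0 : exists j, c j != 0 by exists j.
have [i [_ _ /assoc_neq0/andP[+ _]]] := combination_order cn cn0 MQ.
by rewrite expf_eq0 m_gt0.
Qed.

(** By [combination_order] the membership of [z] in the valuation ring depends
    only on the smallest [n j], which is the same for all places over
    [alpha_l]. *)
Lemma over_branch_unique P Q : over_branch P -> over_branch Q -> P = Q.
Proof.
move=> MP MQ; apply: place_ext; apply/seteqP.
suff h P' Q' : over_branch P' -> over_branch Q' -> O P' `<=` O Q' by split; exact: h.
move=> {P Q MP MQ} MP MQ z; have [c zE] := combinationP z.
have [->|z0] := eqVneq z 0; first by move=> _; exact: vr0.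
have cn0 : exists j, c j != 0 by apply: combination_neq0; rewrite -zE.
have [n cn] := term_orderP c.
have [i [ci i_min hi]] := combination_order cn cn0 MP.
have [i' [ci' i'_min hi']] := combination_order cn cn0 MQ.
move/(vrX m); rewrite zE => /(assoc_expz_vr pi0 MP hi) ni.
apply: (vr_root m_gt0); apply/(assoc_expz_vr pi0 MQ hi').
exact: le_trans (i_min _ ci').
Qed.

Variables laminv u : int.
Hypothesis laminvE : laminv * (lam l)%:Z = 1 + m%:Z * u.

(** The element [y^laminv (x - alpha_l)^(- u)] is a uniformizer: its [m]-th
    power is [x - alpha_l] up to a unit, because
    [laminv lam_l - m u = 1]. *)
Lemma power_valuation Q z : over_branch Q -> z != 0 ->
  assoc Q (z ^+ m) (pi l ^ valuation Q z).
Proof.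
move=> MQ z0.
have order w : w != 0 -> exists n : int, assoc Q (w ^+ m) (pi l ^ n).
  move=> w0; have [c wE] := combinationP w; have [n cn] := term_orderP c.
  have cn0 : exists j, c j != 0 by apply: combination_neq0; rewrite -wE.
  by have [i [_ _ hi]] := combination_order cn cn0 MQ; exists (n i); rewrite wE.
pose t := y ^ laminv * pi l ^ (- u).
have t0 : t != 0 by rewrite mulf_neq0 ?expfz_neq0 ?y_neq0.
have tm : assoc Q (t ^+ m) (pi l).
  rewrite exprMn !exprzX.
  have piE : pi l = (pi l ^+ lam l) ^ laminv * (pi l ^+ m) ^ (- u).
    rewrite !exprnP !exprz_exp -expfzDr //.
    have -> : (lam l)%:Z * laminv + m%:Z * - u = 1 by lia.
    by rewrite expr1z.
  rewrite [X in assoc _ _ X]piE; apply: assocM; last by apply: assoc_refl; rewrite expfz_neq0 ?expf_neq0.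
  by apply: assocXz; exact: curve_over_branch.
have Mt : maximal_ideal Q t.
  have Ot : O Q t by apply: (vr_root m_gt0); apply: assoc_vr tm _; exact: maximal_vr.
  case: (vr_unitVmax Ot) => // /(@unitX _ _ _ _ _ m) Utm.
  case: (maximal_unit MQ); apply: assoc1_unit.
  exact: assoc_trans (assoc_sym tm) (unit_assoc1 Utm).
have t_order w (n : int) : assoc Q (w ^+ m) (pi l ^ n) -> assoc Q w (t ^ n).
  move=> wn; apply: (assoc_root m_gt0); apply: assoc_trans wn _.
  by rewrite exprzX; apply: assocXz; exact: assoc_sym.
have Ut : uniformizer Q t.
  apply: uniformizerP => // w w0; have [n hn] := order w w0.
  by exists n; exact: t_order.
by have [n hn] := order z z0; rewrite (valuationE Ut (t_order _ _ hn)).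
Qed.

Lemma valuation_over_branch Q z (n : int) : over_branch Q ->
  assoc Q (z ^+ m) (pi l ^ n) -> valuation Q z = n.
Proof.
move=> MQ zn; have z0 : z != 0.
  by have /andP[] := assoc_neq0 zn; rewrite expf_eq0 m_gt0.
apply: (assoc_expz_inj pi0 MQ).
exact: assoc_trans (assoc_sym (power_valuation MQ z0)) zn.
Qed.

Lemma term_valuation_ge Q c j : over_branch Q -> c j != 0 ->
  valuation Q (combination c) <= valuation Q (in_alg F (c j) * y ^+ j).
Proof.
move=> MQ cj; have [n cn] := term_orderP c.
have cn0 : exists j, c j != 0 by exists j.
have [i [ci i_min hi]] := combination_order cn cn0 MQ.
rewrite (valuation_over_branch MQ hi) (valuation_over_branch MQ ((cn j cj).1 Q MQ)).
exact: i_min cj.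
Qed.

Lemma leading_term Q c : over_branch Q -> combination c != 0 ->
  exists j, [/\ c j != 0,
    valuation Q (in_alg F (c j) * y ^+ j) = valuation Q (combination c) &
    exists k : int, valuation Q (combination c) = m%:Z * k + j%:Z * (lam l)%:Z].
Proof.
move=> MQ c0; have [n cn] := term_orderP c.
have [i [ci i_min hi]] := combination_order cn (combination_neq0 c0) MQ.
exists i; rewrite (valuation_over_branch MQ hi).
split=> //; last exact: (cn i ci).2.
exact: valuation_over_branch MQ ((cn i ci).1 Q MQ).
Qed.

End TotallyRamified.

(** The Kummer automorphism [y |-> zeta y] over K(x). *)
Definition deck_transformation (zeta : K) (sigma : F -> F) :=
  (forall a, sigma (in_alg F a) = in_alg F a) /\
  sigma y = funfield_const F zeta * y.

Lemma deck_combination zeta (sigma : {rmorphism F -> F}) c :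
  deck_transformation zeta sigma ->
  sigma (combination c) =
    \sum_(j < m) in_alg F (c j) * y ^+ j * funfield_const F (zeta ^+ j).
Proof.
move=> [sigma_alg sigma_y]; rewrite /combination rmorph_sum; apply: eq_bigr => j _.
rewrite rmorphM sigma_alg rmorphXn sigma_y exprMn -mulrA; congr (_ * _).
by rewrite mulrC -rmorphXn.
Qed.

Section Kummer.

Variables (l : 'I_r) (Q : place (funfield_const F)).
Hypotheses (lam_coprime : coprime m (lam l)) (MQ : over_branch l Q).

(** A shorter equation would be a vanishing combination of the [y^j], against
    [combination_eq0]. *)
Lemma minPoly_y : minPoly 1 y = 'X^m - (y ^+ m)%:P.
Proof.
have szX : size ('X^m - (y ^+ m)%:P) = m.+1 by exact: size_XnsubC.
have le_m : (m.+1 <= size (minPoly 1 y))%N.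
  rewrite ltnNge; apply/negP => szq.
  have q_alg i : exists a, (minPoly 1 y)`_i = in_alg F a.
    by have /polyOverP/(_ i)/vlineP[a ->] := minPolyOver 1 y; exists a.
  have [c cE] := choice q_alg.
  have c0 : combination (fun j : 'I_m => c j) = 0.
    have /eqP := root_minPoly 1 y; rewrite (horner_coef_wide _ szq) => <-.
    by apply: eq_bigr => j _; rewrite cE.
  have szq1 : ((size (minPoly 1 y)).-1 < m)%N by rewrite prednK // size_minPoly.
  have := combination_eq0 lam_coprime MQ c0 (Ordinal szq1).
  move/(congr1 (in_alg F)); rewrite -cE rmorph0 => /eqP.
  by rewrite -lead_coefE (monicP (monic_minPoly 1 y)) oner_eq0.
apply/eqP; rewrite -eqp_monic ?monic_minPoly ?monicXnsubC // -dvdp_size_eqp ?minPoly_dvd_Xm //.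
rewrite eqn_leq szX le_m andbT -szX.
by apply: dvdp_leq minPoly_dvd_Xm; rewrite -size_poly_eq0 szX.
Qed.

Lemma deck_transformation_exists (zeta : K) : zeta ^+ m = 1 ->
  exists sigma : {rmorphism F -> F}, deck_transformation zeta sigma.
Proof.
move=> zeta1; pose y' := funfield_const F zeta * y.
have y'_root : root (map_poly \1%VF (minPoly 1 y)) y'.
  rewrite lfun1_poly minPoly_y rootE !hornerE exprMn -rmorphXn zeta1 rmorph1 mul1r.
  by rewrite subrr.
pose f := kHomExtend 1 \1 y y'.
have f_hom : kHom 1 {:F} f.
  by rewrite -Fgen; apply: kHomExtendP y'_root => //; exact: kHom1.
have fM : monoid_morphism f by apply/kHom_monoid_morphism.
pose g : F -> F := f.
have gB : zmod_morphism g by exact: raddfB.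
pose gBm := GRing.isZmodMorphism.Build _ _ g gB.
pose gMm := GRing.isMonoidMorphism.Build _ _ g fM.
pose sigma : {rmorphism F -> F} := HB.pack g gBm gMm.
exists sigma; split=> [a|].
  rewrite -[LHS]/(f (in_alg F a)) kHomExtend_id ?lfunE //; exact: in_alg_1.
exact: (kHomExtend_val (kHom1 1 1) y'_root).
Qed.

Lemma deck_inverse zeta (sigma tau : {rmorphism F -> F}) :
  zeta != 0 -> deck_transformation zeta sigma -> deck_transformation zeta^-1 tau ->
  cancel tau sigma.
Proof.
move=> z0 [sigma_alg sigma_y] [tau_alg tau_y] z; have [c ->] := combinationP z.
rewrite (deck_combination c (conj tau_alg tau_y)) rmorph_sum.
apply: eq_bigr => j _; rewrite !rmorphM sigma_alg rmorphXn sigma_y.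
have -> : sigma (funfield_const F (zeta^-1 ^+ j)) = funfield_const F (zeta^-1 ^+ j).
  exact: sigma_alg.
rewrite exprMn -mulrA; congr (_ * _).
by rewrite mulrAC -rmorphXn -rmorphM -exprMn divff // expr1n rmorph1 mul1r.
Qed.

End Kummer.

Section TwoPlaces.

Variables (l1 l2 : 'I_r) (Q1 Q2 : place (funfield_const F)).
Hypotheses (l1_coprime : coprime m (lam l1)) (l2_coprime : coprime m (lam l2)).
Hypotheses (MQ1 : over_branch l1 Q1) (MQ2 : over_branch l2 Q2).
Hypothesis m_neq0 : m%:R != 0 :> K.

Definition regular_off z := forall P, P <> Q1 -> P <> Q2 -> O P z.

Lemma unity_root_neq0 (zeta : K) : zeta ^+ m = 1 -> zeta != 0.
Proof.
move=> zeta1; have : zeta ^+ m != 0 by rewrite zeta1 oner_eq0.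
by rewrite expf_eq0 m_gt0.
Qed.

(** An automorphism over K(x) permutes the places over each point of the line,
    so it fixes [Q1] and [Q2], which are alone over their points, and
    permutes the other places. *)
Lemma deck_regular_off zeta (sigma : {rmorphism F -> F}) z :
  zeta ^+ m = 1 -> deck_transformation zeta sigma ->
  regular_off z -> regular_off (sigma z).
Proof.
move=> zeta1 sigmaP z_reg P PQ1 PQ2; have [sigma_alg _] := sigmaP.
have zeta0 := unity_root_neq0 zeta1.
have [|tau tauP] := deck_transformation_exists l1_coprime MQ1 (zeta := zeta^-1).
  by rewrite exprVn zeta1 invr1.
have sigma_const a : sigma (funfield_const F a) = funfield_const F a by exact: sigma_alg.
have [P' P'E] := pullback_placeP P (deck_inverse zeta0 sigmaP tauP) sigma_const.
have over_P' l : over_branch l P' -> over_branch l P.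
  have fixpi : sigma (pi l) = pi l by exact: sigma_alg.
  by move=> /maximalE[+ h]; rewrite P'E fixpi => Opi; apply/maximalE; split=> //;
    move: h; rewrite P'E fmorphV fixpi.
rewrite -P'E; apply: z_reg => P'Q.
  by apply/PQ1/(over_branch_unique l1_coprime) => //; apply: over_P'; rewrite P'Q.
by apply/PQ2/(over_branch_unique l2_coprime) => //; apply: over_P'; rewrite P'Q.
Qed.

Lemma primitive_root_exists : exists zeta : K, m.-primitive_root zeta.
Proof.
have [rs rsE] := closed_field_poly_normal ('X^m - 1 : {poly K}).
rewrite (monicP (monicXnsubC 1 m_gt0)) scale1r in rsE.
have rs_size : size rs = m.
  by apply/eqP; rewrite -eqSS -(size_prod_XsubC rs id) -rsE size_XnsubC.
have rs_uniq : uniq rs.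
  by rewrite -separable_prod_XsubC -rsE; exact: separable_Xn_sub_1.
have rs_unity : all m.-unity_root rs.
  apply/allP => a rs_a; by rewrite /root_of_unity rsE root_prod_XsubC.
have /hasP[zeta _ zetaP] := cyclic.has_prim_root m_gt0 rs_unity rs_uniq (eq_leq (esym rs_size)).
by exists zeta.
Qed.

Lemma sum_unity_root (w : K) : w ^+ m = 1 -> w != 1 -> \sum_(k < m) w ^+ k = 0.
Proof.
move=> w1 wN1; apply/eqP; have := subrX1 w m; rewrite w1 subrr => /esym/eqP.
by rewrite mulf_eq0 subr_eq0 (negPf wN1).
Qed.

(** The terms of a combination are its eigencomponents: up to the unit [m],
    the [j]-th one is the average of the conjugates of the sum, with weights
    [zeta^(- k j)], by orthogonality of the powers of [zeta]. *)
Lemma term_regular_off c j :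
  regular_off (combination c) -> regular_off (in_alg F (c j) * y ^+ j).
Proof.
move=> c_reg P PQ1 PQ2; have [zeta zetaP] := primitive_root_exists.
have zeta_m : zeta ^+ m = 1 by exact: prim_expr_order.
have zeta0 := unity_root_neq0 zeta_m.
have zetaX k : (zeta ^+ k) ^+ m = 1 by rewrite exprAC zeta_m expr1n.
have [sigma sigmaP] := choice (fun k => deck_transformation_exists l1_coprime MQ1 (zetaX k)).
pose f (i : 'I_m) := in_alg F (c i) * y ^+ i.
have average : funfield_const F m%:R * f j =
    \sum_(k < m) funfield_const F ((zeta ^+ k) ^- j) * sigma k (combination c).
  under eq_bigr => k _ do rewrite (deck_combination c (sigmaP k)) mulr_sumr.
  rewrite exchange_big /=.
  have inner i : \sum_(k < m) funfield_const F ((zeta ^+ k) ^- j) *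
        (f i * funfield_const F ((zeta ^+ k) ^+ i)) =
      f i * funfield_const F (\sum_(k < m) (zeta ^+ i / zeta ^+ j) ^+ k).
    rewrite rmorph_sum mulr_sumr; apply: eq_bigr => k _.
    rewrite mulrCA -rmorphM; congr (_ * funfield_const F _).
    by rewrite mulrC expr_div_n ![(zeta ^+ k) ^+ _]exprAC.
  under eq_bigr => i _ do rewrite inner.
  rewrite (bigD1 j) //= [X in _ + X]big1 ?addr0 => [|i ij].
    rewrite divff ?expf_neq0 // mulrC; congr (_ * funfield_const F _).
    under eq_bigr => k _ do rewrite expr1n.
    by rewrite sumr_const card_ord.
  have ratio_m : (zeta ^+ i / zeta ^+ j) ^+ m = 1 by rewrite expr_div_n !zetaX divr1.
  have ratio_neq1 : zeta ^+ i / zeta ^+ j != 1.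
    apply: contra_neq ij => /(canRL (divfK (expf_neq0 j zeta0))); rewrite mul1r.
    move=> /eqP; rewrite (eq_prim_root_expr zetaP) => /eqP.
    by rewrite !modn_small // => /val_inj.
  rewrite (sum_unity_root ratio_m ratio_neq1) -[RHS](mulr0 (f i)); congr (_ * _).
  exact: rmorph0 (funfield_const F).
have [_ Om Omv] := unit_const P m_neq0.
rewrite -[X in O P X](mulKf (_ : funfield_const F m%:R != 0)) ?fmorph_eq0 //.
rewrite average; apply: vrM; first by rewrite -fmorphV; exact: vr_const.
apply: vr_sum => k _; apply: vrM; first exact: vr_const.
exact: (deck_regular_off (zetaX k) (sigmaP k)).
Qed.

Hypothesis l1Nl2 : l1 != l2.
Variables laminv u : int.
Hypotheses (laminv1 : laminv * (lam l1)%:Z = 1 + m%:Z * u) (lam12 : lam l1 = lam l2).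

Lemma over_branch_inj l l' P : over_branch l P -> over_branch l' P -> l = l'.
Proof.
move=> Ml Ml'; apply/eqP; apply: contraPT Ml' => ll' Ml'.
apply: (maximal_unit Ml'); apply: (linear_factor_unit Ml).
by rewrite (inj_eq alpha_inj) eq_sym.
Qed.

Lemma Q1_neq_Q2 : Q1 <> Q2.
Proof.
move=> Q12; move: MQ1; rewrite Q12 => h.
by move/eqP: l1Nl2; apply; exact: over_branch_inj MQ2.
Qed.

Lemma pole_divisor2P z (s1 s2 : nat) :
  pole_divisor z = prime_divisor Q1 *+ s1 + prime_divisor Q2 *+ s2 <->
  [/\ regular_off z, Num.max 0 (- valuation Q1 z) = s1%:Z
    & Num.max 0 (- valuation Q2 z) = s2%:Z].
Proof.
have D P : (prime_divisor Q1 *+ s1 + prime_divisor Q2 *+ s2) P =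
    (`[<P = Q1>] : nat)%:Z *+ s1 + (`[<P = Q2>] : nat)%:Z *+ s2.
  by rewrite addrfctE !natmulfctE.
have D1 : (prime_divisor Q1 *+ s1 + prime_divisor Q2 *+ s2) Q1 = s1%:Z.
  by rewrite D asboolT // asboolF ?mul0rn ?addr0 -?pmulrn ?natz //; exact: Q1_neq_Q2.
have D2 : (prime_divisor Q1 *+ s1 + prime_divisor Q2 *+ s2) Q2 = s2%:Z.
  rewrite D asboolF; last by move=> /esym/Q1_neq_Q2.
  by rewrite asboolT // mul0rn add0r natz.
split=> [zE|[z_reg z1 z2]].
  have zP P : Num.max 0 (- valuation P z) = (prime_divisor Q1 *+ s1 + prime_divisor Q2 *+ s2) P.
    by rewrite -zE.
  split=> [P PQ1 PQ2||]; [|by rewrite zP D1|by rewrite zP D2].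
  have := zP P; rewrite D !asboolF // !mul0rn addr0 => /eqP.
  by rewrite eq_maxl oppr_le0 => /vr_valuationE.
apply/funext => P; have [PQ1|PQ1] := EM (P = Q1); first by rewrite PQ1 D1.
have [PQ2|PQ2] := EM (P = Q2); first by rewrite PQ2 D2.
rewrite D !asboolF // !mul0rn addr0 /pole_divisor.
by apply/eqP; rewrite eq_maxl oppr_le0; exact/vr_valuationE/z_reg.
Qed.

Lemma ym_exprz (q : int) : exists a, (y ^+ m) ^ q = in_alg F a.
Proof.
have /vlineP[a yE] := ym_1; exists (a ^ q).
by rewrite yE -[a *: 1]/(in_alg F a) fmorphXz.
Qed.

(** The term of smallest order at [Q1] has the same order [- s1] there as [z].
    It is a multiple of [y^j] with [j lam_l1] congruent to [- i] modulo [m],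
    that is, [j] congruent to [- i laminv]; since [y^m] is a rational function
    of [x], [y^j] may be replaced by [y^(- i laminv)]. *)
Lemma leading_monomial z (i s1 s2 : nat) : (0 < i < m)%N ->
  (exists j1 : nat, s1 = i + m * j1)%N ->
  pole_divisor z = prime_divisor Q1 *+ s1 + prime_divisor Q2 *+ s2 ->
  exists a : ratfun K, let g := in_alg F a * y ^ (- (i%:Z * laminv)) in
    [/\ a != 0, regular_off g, - s1%:Z <= valuation Q1 g & - s2%:Z <= valuation Q2 g].
Proof.
move=> i_bounds [j1 s1E] /pole_divisor2P[z_reg z1 z2].
have s1_gt0 : (0 < s1)%N by lia.
have v1 : valuation Q1 z = - s1%:Z.
  by move: z1; case: (lerP 0 (- valuation Q1 z)) => ? ?; lia.
have v2 : - s2%:Z <= valuation Q2 z.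
  by move: z2; case: (lerP 0 (- valuation Q2 z)) => ? ?; lia.
have z0 : z != 0.
  apply/eqP => z0; have := valuation_ge0 (vr0 Q1); rewrite -z0 v1; lia.
have [c zE] := combinationP z; rewrite zE in z0 v1 v2 z_reg.
have [j [cj vj [k vk]]] := leading_term l1_coprime laminv1 MQ1 z0.
have laminv2 : laminv * (lam l2)%:Z = 1 + m%:Z * u by rewrite -lam12.
have vj2 := term_valuation_ge l2_coprime laminv2 MQ2 cj.
(* Multiply - s1 = m k + j lam_l1 by laminv and use laminv lam_l1 = 1 + m u. *)
have jE : exists q : int, j%:Z = - (i%:Z * laminv) + m%:Z * q.
  exists (- (j1%:Z * laminv) - k * laminv - j%:Z * u).
  have : laminv * (- s1%:Z) = laminv * (m%:Z * k + j%:Z * (lam l1)%:Z).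
    by rewrite -v1 vk.
  rewrite mulrDr [laminv * (j%:Z * _)]mulrCA laminv1 s1E PoszD PoszM; lia.
have [q jq] := jE; have [b bE] := ym_exprz q.
have gE : in_alg F (c j) * y ^+ j = in_alg F (c j * b) * y ^ (- (i%:Z * laminv)).
  rewrite exprnP jq expfzDr ?y_neq0 // -exprz_exp -exprnP bE rmorphM.
  by rewrite mulrA mulrAC.
have b0 : b != 0.
  have ym0 : (y ^+ m) ^ q != 0 by rewrite expfz_neq0 // expf_neq0 // y_neq0.
  by apply: contra_neq ym0 => b0; rewrite bE b0 rmorph0.
exists (c j * b); split; first exact: mulf_neq0 cj b0.
- rewrite -gE; exact: term_regular_off.
- by rewrite -gE vj v1.
- by rewrite -gE; exact: le_trans v2 vj2.
Qed.

Lemma vr_clear_pole Q l g (s : nat) : over_branch l Q -> g != 0 ->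
  assoc Q (g ^+ m) (pi l ^ valuation Q g) -> - s%:Z <= valuation Q g ->
  O Q (g ^+ m * pi l ^+ s).
Proof.
move=> MQ g0 gm gs; have pil0 : pi l != 0 by exact: linear_factor_neq0.
have h : assoc Q (g ^+ m * pi l ^+ s) (pi l ^ (valuation Q g + s%:Z)).
  rewrite expfzDr //; apply: assocM => //; apply: assoc_refl.
  by rewrite expf_neq0.
by apply/(assoc_expz_vr pil0 MQ h); rewrite -lerBlDr sub0r.
Qed.

(** Multiplied by [(x - alpha_l1)^s1 (x - alpha_l2)^s2], the [m]-th power of the
    monomial becomes regular at all finite places, so [degree_bound]
    applies. *)
Lemma monomial_bound a (N : int) (s1 s2 : nat) (e : 'I_r -> int) :
  let g := in_alg F a * y ^ N in
  [/\ a != 0, regular_off g, - s1%:Z <= valuation Q1 g & - s2%:Z <= valuation Q2 g] ->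
  (forall k, k != l1 -> k != l2 -> m%:Z * e k + N * (lam k)%:Z < m%:Z) ->
  m%:Z * e l1 + N * (lam l1)%:Z + s1%:Z < m%:Z ->
  m%:Z * e l2 + N * (lam l2)%:Z + s2%:Z < m%:Z ->
  m%:Z * \sum_k e k + N * \sum_k (lam k)%:Z <= 0.
Proof.
move=> g [a0 g_reg g1 g2] e_lt e1 e2.
have g0 : g != 0 by rewrite mulf_neq0 ?expfz_neq0 ?y_neq0 // fmorph_eq0.
have laminv2 : laminv * (lam l2)%:Z = 1 + m%:Z * u by rewrite -lam12.
have O1 := vr_clear_pole MQ1 g0 (power_valuation l1_coprime laminv1 MQ1 g0) g1.
have O2 := vr_clear_pole MQ2 g0 (power_valuation l2_coprime laminv2 MQ2 g0) g2.
pose n k := N * (lam k)%:Z + ((k == l1) * s1)%N%:Z + ((k == l2) * s2)%N%:Z.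
have gmE : in_alg F a ^+ m * \prod_k pi k ^ (N * (lam k)%:Z) = g ^+ m.
  by rewrite /g exprMn y_exprz.
have extra l (s : nat) : \prod_k pi k ^ ((k == l) * s)%N%:Z = pi l ^+ s.
  rewrite (bigD1 l) //= eqxx mul1n big1 ?mulr1 // => k /negPf->.
  by rewrite mul0n expr0z.
have gnE : in_alg F a ^+ m * \prod_k pi k ^ n k = g ^+ m * pi l1 ^+ s1 * pi l2 ^+ s2.
  rewrite -gmE -mulrA -mulrA; congr (_ * _); rewrite mulrA -!extra -!big_split /=.
  by apply: eq_bigr => k _; rewrite /n !expfzDr ?linear_factor_neq0.
rewrite [N * _]mulr_sumr; apply: (degree_bound (F := F) alpha_inj (n := n) m_gt0 a0).
- move=> b P Mb; rewrite gnE.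
  have Opi l (s : nat) : O P (pi l ^+ s).
    by apply: vrX; apply: vr_poly; exact: over_finite_vr Mb.
  have [->|PQ1] := EM (P = Q1).
    apply: vrM => //; apply: vrX; apply: vr_poly; exact: over_finite_vr MQ1.
  have [->|PQ2] := EM (P = Q2).
    rewrite mulrAC; apply: vrM => //; apply: vrX; apply: vr_poly; exact: over_finite_vr MQ2.
  by apply: vrM => //; apply: vrM => //; apply: vrX; exact: g_reg.
- move=> P nOx; rewrite gmE; apply: vrX; apply: g_reg => PQ; apply: nOx; rewrite PQ.
    exact: over_finite_vr MQ1.
  exact: over_finite_vr MQ2.
- move=> k; rewrite /n; have [->|k1] := eqVneq k l1.
    by rewrite (negPf l1Nl2) mul1n mul0n addr0 addrA.
  have [->|k2] := eqVneq k l2; first by rewrite mul0n mul1n addr0 addrA.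
  by rewrite !mul0n !addr0; exact: e_lt.
Qed.

(** The [m]-th power of a product of powers of the [x - alpha_k] and of [y] is a
    product of powers of the [x - alpha_k], from which all orders are
    visible. *)
Lemma monomial_pole_divisor (e : 'I_r -> int) (N : int) (s1 s2 : nat) :
  (forall k, k != l1 -> k != l2 -> 0 <= m%:Z * e k + N * (lam k)%:Z) ->
  m%:Z * \sum_k e k + N * \sum_k (lam k)%:Z <= 0 ->
  Num.max 0 (- (m%:Z * e l1 + N * (lam l1)%:Z)) = s1%:Z ->
  Num.max 0 (- (m%:Z * e l2 + N * (lam l2)%:Z)) = s2%:Z ->
  exists z, pole_divisor z = prime_divisor Q1 *+ s1 + prime_divisor Q2 *+ s2.
Proof.
move=> e_ge sum_le e1 e2; pose n k := m%:Z * e k + N * (lam k)%:Z.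
pose z := \prod_k pi k ^ e k * y ^ N; exists z.
have laminv2 : laminv * (lam l2)%:Z = 1 + m%:Z * u by rewrite -lam12.
have zm : z ^+ m = \prod_k pi k ^ n k by rewrite exprMn y_exprz prod_linear_mul.
have val l Q : over_branch l Q -> assoc Q (z ^+ m) (pi l ^ n l).
  move=> Ml; rewrite zm; have := prod_linear_at_finite alpha n Ml.
  suff -> : \sum_(k | alpha k == alpha l) n k = n l by [].
  by rewrite (eq_bigl (pred1 l)) ?big_pred1_eq // => k; rewrite /= (inj_eq alpha_inj).
apply/pole_divisor2P; split.
- move=> P PQ1 PQ2; apply: (vr_root m_gt0); rewrite zm.
  have [Ox|nOx] := EM (O P x); last first.
    apply/(assoc_infinity_vr nOx (prod_linear_at_infinity alpha n nOx)).
    by rewrite big_split /= -!mulr_sumr.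
  apply: vr_prod => k _; have Opi : O P (pi k) by exact: vr_poly.
  have unit_l l Q : coprime m (lam l) -> over_branch l Q -> P <> Q ->
      valuation_unit P (pi l).
    move=> lco MQ PQ; case: (vr_unitVmax (vr_poly ('X - (alpha l)%:P) Ox)) => // Ml.
    by case: PQ; exact: (over_branch_unique lco).
  have unit_vr l (q : int) : valuation_unit P (pi l) -> O P (pi l ^ q).
    move=> /unit_assoc1/(assocXz q); rewrite exp1rz => h; apply: assoc_vr h _; exact: vr1.
  have [->|k1] := eqVneq k l1; first exact/unit_vr/(unit_l _ Q1).
  have [->|k2] := eqVneq k l2; first exact/unit_vr/(unit_l _ Q2).
  have := e_ge k k1 k2; rewrite -/(n k); case: (n k) => // q _.
  exact: vrX.
- by rewrite (valuation_over_branch l1_coprime laminv1 MQ1 (val _ _ MQ1)).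
- by rewrite (valuation_over_branch l2_coprime laminv2 MQ2 (val _ _ MQ2)).
Qed.

End TwoPlaces.

End Curve.

(** * Pole orders at two totally ramified places *)

Lemma ceil_div_itv (a : int) (m : nat) : (0 < m)%N ->
  m%:Z * (Num.ceil (a%:~R / m%:R : rat) - 1) < a <= m%:Z * Num.ceil (a%:~R / m%:R : rat).
Proof.
move=> m_gt0; have m0 : 0 < (m%:R : rat) by rewrite ltr0n.
have := ceil_itv (a%:~R / m%:R : rat).
rewrite ltr_pdivlMr // ler_pdivrMr // -[m%:R]/(m%:Z%:~R).
by rewrite -![_ * m%:~R]intrM ltr_int ler_int ![_ * m%:Z]mulrC.
Qed.

Lemma sum_change_two (I : finType) (i j : I) (f : I -> int) (a b : int) : i != j ->
  \sum_k (if k == i then a else if k == j then b else f k) =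
  \sum_k f k - f i - f j + a + b.
Proof.
move=> ij; rewrite (bigD1 i) //= (bigD1 j) 1?eq_sym //= eqxx [j == i]eq_sym (negPf ij) eqxx.
rewrite [in RHS](bigD1 i) //= [in RHS](bigD1 j) 1?eq_sym //=.
set A := \sum_(_ | _) _; set B := \sum_(_ | _) _; have -> : A = B.
  by apply: eq_bigr => k /andP[/negPf-> /negPf->].
ring.
Qed.

Section PoleCriterion.

Variables (K : closedFieldType) (r : nat) (alpha : 'I_r -> K).
Variables (m : nat) (lam : 'I_r -> nat) (F : fieldExtType (ratfun K)) (y : F).
Hypotheses (alpha_inj : injective alpha) (m_gt0 : (0 < m)%N).
Hypothesis Fgen : <<1; y>>%VS = {:F}%VS.
Hypothesis curve : y ^+ m = \prod_k linear_factor F alpha k ^+ lam k.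

Variables (l1 l2 : 'I_r) (Q1 Q2 : place (funfield_const F)).
Hypotheses (l1_coprime : coprime m (lam l1)) (l2_coprime : coprime m (lam l2)).
Hypotheses (MQ1 : over_branch alpha l1 Q1) (MQ2 : over_branch alpha l2 Q2).
Hypothesis l1Nl2 : l1 != l2.
Variables laminv u : int.
Hypotheses (laminv1 : laminv * (lam l1)%:Z = 1 + m%:Z * u) (lam12 : lam l1 = lam l2).

(** [S k] and [C] stand for the ceilings of [i laminv lam_k / m] and
    [i laminv lam0 / m].  The upper inequality on [C] is strict because [m],
    being prime to [laminv] and to [lam0], does not divide
    [i laminv lam0]. *)
Variables (i : nat) (S : 'I_r -> int) (C : int).
Hypothesis i_bounds : (0 < i < m)%N.
Hypothesis S_ceil : forall k,
  m%:Z * (S k - 1) < i%:Z * laminv * (lam k)%:Z <= m%:Z * S k.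
Hypothesis C_ceil :
  m%:Z * (C - 1) < i%:Z * laminv * (\sum_k (lam k)%:Z) < m%:Z * C.

(** At a branch point with exponent [lam_l1] the fraction is
    [i / m + i u], with [0 < i / m < 1]. *)
Lemma ceil_branch k : lam k = lam l1 -> S k = i%:Z * u + 1.
Proof.
move=> lamk; have := S_ceil k; rewrite lamk -mulrA laminv1.
move: (S k) i_bounds => s; nia.
Qed.

(** Orders of the rational factor of the monomial: the least ones allowed away
    from [Q1] and [Q2], and those which produce the pole orders [i + m j1] and
    [i + m j2] at these two places. *)
Let exponents (j1 j2 : int) k : int :=
  if k == l1 then i%:Z * u - j1 else if k == l2 then i%:Z * u - j2 else S k.

Let sum_exponents j1 j2 :
  \sum_k exponents j1 j2 k = \sum_k S k - 2 - j1 - j2.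
Proof.
rewrite sum_change_two // !ceil_branch //; set T := \sum_k S k; lia.
Qed.

Lemma pole_pair_exists (j1 j2 : int) (s1 s2 : nat) :
  \sum_k S k - C - 1 <= j1 + j2 ->
  Num.max 0 (i%:Z + m%:Z * j1) = s1%:Z -> Num.max 0 (i%:Z + m%:Z * j2) = s2%:Z ->
  pole_semigroup2 Q1 Q2 (s1, s2).
Proof.
move=> j_ge s1E s2E.
have N1 : i%:Z * laminv * (lam l1)%:Z = i%:Z + m%:Z * (i%:Z * u).
  by rewrite -mulrA laminv1; ring.
apply: (monomial_pole_divisor alpha_inj m_gt0 Fgen curve l1_coprime l2_coprime
  MQ1 MQ2 l1Nl2 laminv1 lam12 (e := exponents j1 j2) (N := - (i%:Z * laminv))).
- move=> k /negPf k1 /negPf k2; rewrite /exponents k1 k2 mulNr.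
  by have := S_ceil k; set b := _ * (lam k)%:Z; set c := S k; lia.
- move: C_ceil; rewrite sum_exponents mulNr.
  by set L := _ * \sum_k _; set T := \sum_k S k in j_ge *; nia.
- rewrite /= -s1E /exponents eqxx mulNr N1; congr (Num.max _ _).
  by set v := i%:Z * u; lia.
- rewrite /= -s2E /exponents eq_sym (negPf l1Nl2) eqxx mulNr -lam12 N1.
  by congr (Num.max _ _); set v := i%:Z * u; lia.
Qed.

Hypothesis m_neq0 : m%:R != 0 :> K.

(** The monomial with pole order [i + m j1] at [Q1] found by [leading_monomial]
    has pole order at most [s2] at [Q2]; [j2] is the largest value that
    [i + m j2 <= s2] permits, which is what [degree_bound] needs there. *)
Lemma pole_pair_bound (j1 s2 : nat) : pole_semigroup2 Q1 Q2 ((i + m * j1)%N, s2) ->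
  exists j2 : int, i%:Z + m%:Z * j2 <= s2%:Z /\ \sum_k S k - C - 1 <= j1%:Z + j2.
Proof.
move=> [z /= zE]; pose j2 := ((s2%:Z - i%:Z) %/ m%:Z)%Z.
have s1E : exists j1' : nat, (i + m * j1 = i + m * j1')%N by exists j1.
have [a aP] := leading_monomial alpha_inj m_gt0 Fgen curve l1_coprime l2_coprime
  MQ1 MQ2 m_neq0 l1Nl2 laminv1 lam12 i_bounds s1E zE.
have m0 : (0 : int) < m%:Z by [].
have j2_lt : s2%:Z - i%:Z < m%:Z * (j2 + 1) by rewrite mulrC; exact: (ltz_ceil _ m0).
have j2_le : m%:Z * j2 <= s2%:Z - i%:Z by by rewrite mulrC; apply: lez_floor; lia.
have N1 : i%:Z * laminv * (lam l1)%:Z = i%:Z + m%:Z * (i%:Z * u).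
  by rewrite -mulrA laminv1; ring.
have le0 := monomial_bound alpha_inj m_gt0 Fgen curve l1_coprime l2_coprime
  MQ1 MQ2 l1Nl2 laminv1 lam12 (e := exponents j1 j2) aP.
have {}le0 : m%:Z * \sum_k exponents j1 j2 k + - (i%:Z * laminv) * \sum_k (lam k)%:Z <= 0.
  apply: le0.
  - move=> k /negPf k1 /negPf k2; rewrite /exponents k1 k2.
    have := S_ceil k; rewrite mulNr; set b := _ * (lam k)%:Z; set c := S k; lia.
  - rewrite /exponents eqxx mulNr N1 PoszD PoszM; set v := i%:Z * u; lia.
  - rewrite /exponents eq_sym (negPf l1Nl2) eqxx mulNr -lam12 N1.
    set v := i%:Z * u; lia.
exists j2; split; first lia.
move: le0 C_ceil; rewrite sum_exponents mulNr.
set L := _ * \sum_k _; set T := \sum_k S k; nia.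
Qed.

End PoleCriterion.

Theorem proposition4p4
  (Fq : finFieldType) (p : nat) (char_Fq : p \in [pchar Fq])
  (K : closedFieldType) (emb : {rmorphism Fq -> K})
  (algK : forall u : K, algebraicOver emb u)
  (r : nat) (alpha : 'I_r -> K) (alpha_inj : injective alpha)
  (m : nat) (m_gt0 : (0 < m)%N) (pNm : ~~ (p %| m)%N)
  (lam : 'I_r -> nat) (lam_bounds : forall k, (1 <= lam k < m)%N)
  (lam0 : nat) (lam0E : lam0 = (\sum_(k < r) lam k)%N)
  (lam0_coprime : gcdn m lam0 = 1%N)
  (F : fieldExtType (ratfun K)) (y : F)
  (Fgen : <<1; y>>%VS = {:F}%VS)
  (curve : y ^+ m =
     \prod_(k < r) (funfield_x F - funfield_const F (alpha k)) ^+ lam k)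
  (l1 l2 : 'I_r) (l1Nl2 : l1 != l2) (lam12 : lam l1 = lam l2)
  (lam1_coprime : gcdn m (lam l1) = 1%N)
  (laminv : int) (laminvE : (laminv * (lam l1)%:Z = 1 %[mod m%:Z])%Z)
  (P1 P2 : place (ratfun_const K))
  (P1zero : is_zero (tofrac ('X - (alpha l1)%:P)) P1)
  (P2zero : is_zero (tofrac ('X - (alpha l2)%:P)) P2)
  (Q1 Q2 : place (funfield_const F))
  (Q1P1 : lies_over Q1 P1) (Q2P2 : lies_over Q2 P2) :
  minimal_generating_set Q1 Q2 =
  [set s : nat * nat | exists i j1 j2 : nat,
     [/\ (1 <= i <= m - 1)%N,
         j1%:Z + j2%:Z =
           \sum_(k < r)
             Num.ceil ((i%:Z * laminv * (lam k)%:Z)%:~R / m%:R : rat)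
           - Num.ceil ((i%:Z * laminv * lam0%:Z)%:~R / m%:R : rat) - 1
       & s = (i + m * j1, i + m * j2)%N]].
Proof.
have coprime1 : coprime m (lam l1) by apply/eqP.
have coprime2 : coprime m (lam l2) by rewrite -lam12.
have m_neq0 : m%:R != 0 :> K.
  by rewrite -(dvdn_pcharf (rmorph_pchar emb char_Fq)).
have curve' : y ^+ m = \prod_k linear_factor F alpha k ^+ lam k.
  by rewrite curve; apply: eq_bigr => k _; rewrite /linear_factor funfield_XsubC.
have over l P (Q : place (funfield_const F)) :
    is_zero (tofrac ('X - (alpha l)%:P)) P -> lies_over Q P -> over_branch alpha l Q.
  move=> /valuation_gt0 MP QP; apply: QP.
  exact: (imageP (in_alg F) MP).
have MQ1 := over _ _ _ P1zero Q1P1; have MQ2 := over _ _ _ P2zero Q2P2.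
have [u laminv1] : exists u : int, laminv * (lam l1)%:Z = 1 + m%:Z * u.
  move/eqP: laminvE; rewrite eqz_mod_dvd => /dvdzP[u uE]; exists u.
  by rewrite [m%:Z * u]mulrC -uE addrC subrK.
pose S (i : nat) k := Num.ceil ((i%:Z * laminv * (lam k)%:Z)%:~R / m%:R : rat).
pose C (i : nat) := Num.ceil ((i%:Z * laminv * lam0%:Z)%:~R / m%:R : rat).
have S_ceil i k : m%:Z * (S i k - 1) < i%:Z * laminv * (lam k)%:Z <= m%:Z * S i k.
  exact: ceil_div_itv.
have lam0Z : lam0%:Z = \sum_k (lam k)%:Z.
  by rewrite lam0E (big_morph Posz PoszD (erefl _)).
have C_ceil i : (0 < i < m)%N ->
    m%:Z * (C i - 1) < i%:Z * laminv * (\sum_k (lam k)%:Z) < m%:Z * C i.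
  move=> i_bounds; rewrite -lam0Z; have /andP[-> /=] := ceil_div_itv (i%:Z * laminv * lam0%:Z) m_gt0.
  rewrite le_eqVlt => /predU1P[C_eq|//].
  (* Equality would make m divide i laminv, hence also i laminv lam_l1, which
     is congruent to i modulo m. *)
  have dv : (m%:Z %| i%:Z * laminv * lam0%:Z)%Z by rewrite C_eq dvdz_mulr.
  rewrite Gauss_dvdzl in dv; last by rewrite /coprimez; apply/eqP; congr Posz.
  have : (m%:Z %| i%:Z * laminv * (lam l1)%:Z)%Z by rewrite dvdz_mulr.
  rewrite -mulrA laminv1 mulrDr mulr1 mulrCA rpredDr ?dvdz_mulr //.
  by move=> /dvdn_leq; lia.
pose bound i i_bounds := pole_pair_bound alpha_inj m_gt0 Fgen curve' coprime1 coprime2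
  MQ1 MQ2 l1Nl2 laminv1 lam12 i_bounds (S_ceil i) (C_ceil i i_bounds) m_neq0.
pose build i i_bounds := pole_pair_exists alpha_inj m_gt0 Fgen curve' coprime1 coprime2
  MQ1 MQ2 l1Nl2 laminv1 lam12 i_bounds (S_ceil i) (C_ceil i i_bounds).
pose t i := \sum_k S i k - C i - 1.
have semigroup1 b : pole_semigroup Q1 b <-> pole_semigroup2 Q1 Q2 (b, 0%N).
  by split=> -[z zE]; exists z; move: zE; rewrite /= mulr0n addr0.
(* The function ((x - alpha_l2) / (x - alpha_l1))^j has its only pole at Q1. *)
have multiple j : pole_semigroup Q1 (m * j)%N.
  apply/semigroup1; pose e k : int := if k == l1 then - j%:Z else if k == l2 then j%:Z else 0.
  apply: (monomial_pole_divisor alpha_inj m_gt0 Fgen curve' coprime1 coprime2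
    MQ1 MQ2 l1Nl2 laminv1 lam12 (e := e) (N := 0)).
  - by move=> k /negPf k1 /negPf k2; rewrite /e k1 k2; lia.
  - by rewrite sum_change_two // big1 // mul0r; lia.
  - by rewrite /e eqxx mul0r /= addr0 mulrN opprK -PoszM; apply/max_idPr.
  - by rewrite /e eq_sym (negPf l1Nl2) eqxx mul0r /= addr0 -PoszM; apply/max_idPl; lia.
have gapP i (j1 : nat) : (0 < i < m)%N -> gaps Q1 (i + m * j1)%N <-> j1%:Z <= t i.
  move=> i_bounds; split=> [gap|le_t].
    rewrite leNgt; apply/negP => lt_t; apply: gap; apply/semigroup1.
    (* For j2 = -1 the value i + m j2 is negative: there is no pole at Q2. *)
    apply: (build i i_bounds j1%:Z (-1)); rewrite -?/(t i); first lia.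
      by rewrite -PoszM -PoszD; apply/max_idPr.
    by apply/max_idPl; lia.
  move=> /semigroup1/(bound i i_bounds)[j2 []]; rewrite -/(t i) => h1 h2; nia.
have partner i (j1 j2 : nat) : (0 < i < m)%N -> j1%:Z + j2%:Z = t i ->
    least_partner Q1 Q2 (i + m * j1)%N = (i + m * j2)%N.
  move=> i_bounds jE.
  have least k : pole_semigroup2 Q1 Q2 ((i + m * j1)%N, k) -> (i + m * j2 <= k)%N.
    by move=> /(bound i i_bounds)[j2' []]; rewrite -/(t i) -jE => h1 h2; nia.
  have attained : pole_semigroup2 Q1 Q2 ((i + m * j1)%N, (i + m * j2)%N).
    apply: (build i i_bounds j1%:Z j2%:Z); rewrite -?/(t i) ?jE //.
      by rewrite -PoszM -PoszD; apply/max_idPr.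
    by rewrite -PoszM -PoszD; apply/max_idPr.
  apply: xget_unique => // k [k_in k_min]; apply/eqP.
  by rewrite eqn_leq k_min //= least.
apply/seteqP; split=> [_ [b gap <-]|_ [i [j1 [j2 [i_bounds jE ->]]]]] /=.
  have bE := divn_eq b m; set i := (b %% m)%N in bE; set j1 := (b %/ m)%N in bE.
  have i_lt : (i < m)%N by rewrite ltn_pmod.
  have i_gt0 : (0 < i)%N.
    by rewrite lt0n; apply/eqP => i0; apply: gap; rewrite bE i0 addn0 mulnC; exact: multiple.
  have i_bounds : (0 < i < m)%N by rewrite i_gt0.
  rewrite addnC mulnC in bE; rewrite bE in gap *.
  have le_t := (gapP i j1 i_bounds).1 gap.
  have [j2 j2E] : exists j2 : nat, j1%:Z + j2%:Z = t i.
    by exists `|t i - j1%:Z|%N; lia.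
  by exists i, j1, j2; split; [lia | exact: j2E | rewrite (partner i j1 j2)].
have {}i_bounds : (0 < i < m)%N by lia.
exists (i + m * j1)%N; first by apply/gapP => //; rewrite /t -jE; lia.
by rewrite (partner i j1 j2).
Qed.
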